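(* Consider the two-dimensional Kepler problem $\ddot x=-\nabla\phi(x)$, $\phi(x)=-\frac1{|x|}$, $x=(x_1,x_2)\in\mathbf{R}^2$, on elliptic orbits ($H<0$) with period $T$. (i) For the symplectic Euler method, $\frac{x_{n+1}-2x_n+x_{n-1}}{h^2}=-\nabla\phi(x_n)$, the errors in the eccentricity $|\mathbf{A}|$ and the angle $\omega$ of the Laplace–Runge–Lenz vector over one period are of order $2$, i.e. $\Delta|\mathbf{A}|=\mathcal{O}(h^2)$ and $\Delta\omega=\mathcal{O}(h^2)$. (ii) For the variational integrator of the first-order discrete Lagrangian $$\mathbb{L}(x_n,x_{n+1},h)=\frac12\frac{|x_{n+1}-x_n|^2}{h^2}-\Big[\phi^{[1]}(x_{n+1}^1,x_n^2)+\phi^{[2]}(x_{n+1}^1,x_{n+1}^2)\Big],\qquad\phi=\phi^{[1]}+\phi^{[2]},$$ with the choice $\phi^{[1]}=\phi^{[2]}$, the errors in the eccentricity and the angle of the Laplace–Runge–Lenz vector over one period are also of order $2$.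
   Context: Superscripts on points denote components. $H=\frac12|\dot x|^2-\frac1{|x|}$. The Laplace–Runge–Lenz (LRL) vector is $\mathbf{A}=(A_1,A_2)$, $A_i=x_i|\dot x|^2-\dot x_i(x\cdot\dot x)-\frac{x_i}{|x|}$. For the exact Kepler problem $\mathbf{A}$ is conserved, $|\mathbf{A}|=\sqrt{A_1^2+A_2^2}$ equals the eccentricity, and $\omega=\arctan(A_2/A_1)$ (a continuous polar angle of $\mathbf{A}$) is the angle relative to the first coordinate axis. The orbit is non-circular and non-collision. The variational integrator of a discrete Lagrangian is given by the discrete Euler–Lagrange equations $\partial_1\mathbb{L}(x_n,x_{n+1},h)+\partial_2\mathbb{L}(x_{n-1},x_n,h)=0$. The symplectic Euler method is the variational integrator of $\frac12\frac{|x_{n+1}-x_n|^2}{h^2}-\phi(x_n)$. The modified equation of such a method is the formal second-order equation $\ddot{x}=-\nabla\phi(x)+hf^{[1]}(x,\dot x)+h^2f^{[2]}(x,\dot x)+\cdots$ whose solution formally interpolates the numerical solution, $x(nh)=x_n$. The errors $\Delta|\mathbf{A}|$, $\Delta\omega$ over one period are the changes of $|\mathbf{A}|(x(t),\dot x(t))$ and $\omega(x(t),\dot x(t))$ along the solution of the modified equation (truncated at any order $h^K$, $K\ge1$), with fixed initial data, over a time interval of length $T$, where $T$ is the period of the Kepler orbit with the same initial data; order is with respect to $h\to0$. *)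

(* Defs.v *)
From Stdlib Require Import Reals Lra Lia.
From Coquelicot Require Import Coquelicot.
Open Scope R_scope.

Definition dot (a b : R * R) : R := fst a * fst b + snd a * snd b.

Definition enorm (a : R * R) : R := sqrt (fst a ^ 2 + snd a ^ 2).

Definition grad (g : R * R -> R) (a : R * R) : R * R :=
  (Derive (fun u => g (u, snd a)) (fst a),
   Derive (fun u => g (fst a, u)) (snd a)).

Definition phi (x : R * R) : R := - (1 / enorm x).

Definition energy (x v : R * R) : R := / 2 * enorm v ^ 2 - 1 / enorm x.

Definition lrl (x v : R * R) : R * R :=
  (fst x * enorm v ^ 2 - fst v * dot x v - fst x / enorm x,
   snd x * enorm v ^ 2 - snd v * dot x v - snd x / enorm x).

(** [(x, v)] solves x'' = F (x, x') at all times satisfying [I] and stays in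
    the phase space {x <> 0}; [v] is the velocity. *)
Definition solves (F : (R * R) * (R * R) -> R * R) (I : R -> Prop)
    (x v : R -> R * R) : Prop :=
  forall t, I t ->
    x t <> (0, 0) /\ is_derive x t (v t) /\ is_derive v t (F (x t, v t)).

Definition kepler_orbit (x v : R -> R * R) : Prop :=
  solves (fun s => opp (grad phi (fst s))) (fun _ => True) x v.

Definition circular (x : R -> R * R) : Prop :=
  exists r, forall t, enorm (x t) = r.

Definition minimal_period (x : R -> R * R) (T : R) : Prop :=
  0 < T /\ (forall t, x (t + T) = x t) /\
  (forall T', 0 < T' < T -> ~ (forall t, x (t + T') = x t)).

Definition along (g : (R * R) * (R * R) -> R) (s d : (R * R) * (R * R))
    (t : R) : R := g (plus s (scal t d)).

(** Class C^n on the open phase space {x <> 0}. *)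
Fixpoint Cn (n : nat) (g : (R * R) * (R * R) -> R) : Prop :=
  match n with
  | O => forall s, fst s <> (0, 0) -> continuous g s
  | S m => forall d,
      (forall s, fst s <> (0, 0) -> ex_derive (along g s d) 0) /\
      Cn m (fun s => Derive (along g s d) 0)
  end.

Definition smooth (F : (R * R) * (R * R) -> R * R) : Prop :=
  forall n, Cn n (fun s => fst (F s)) /\ Cn n (fun s => snd (F s)).

(** The sum f 0 + h f 1 + ... + h^K f K. *)
Definition truncation (f : nat -> (R * R) * (R * R) -> R * R) (K : nat) (h : R)
    (s : (R * R) * (R * R)) : R * R :=
  sum_n (fun j => scal (h ^ j) (f j s)) K.

(** A second-order difference equation is given by its residual
    [Psi x_{n-1} x_n x_{n+1} h], normalised so that it tends to a multiple of
    x'' + grad phi (x) as h -> 0.  The formal series f 0 + h f 1 + ... is its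
    modified equation if, for every K, the solution of the equation truncated
    after h^K satisfies the difference equation up to a defect O(h^(K+1)),
    that is, if it interpolates the discrete solution to every order in h.
    The equation being autonomous, it suffices to look at times -h, 0, h. *)
Definition modified_equation (Psi : R * R -> R * R -> R * R -> R -> R * R)
    (f : nat -> (R * R) * (R * R) -> R * R) : Prop :=
  (forall j, smooth (f j)) /\
  (forall s, fst s <> (0, 0) -> f O s = opp (grad phi (fst s))) /\
  (forall (K : nat) (x0 v0 : R * R), x0 <> (0, 0) ->
    exists C h0, 0 < h0 /\ forall h, 0 < h < h0 ->
      exists x v : R -> R * R,
        solves (truncation f K h) (fun t => - h <= t <= h) x v /\
        x 0 = x0 /\ v 0 = v0 /\
        enorm (Psi (x (- h)) (x 0) (x h) h) <= C * h ^ (K + 1)).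

Definition symplectic_euler (xm x xp : R * R) (h : R) : R * R :=
  plus (scal (/ h ^ 2) (plus (minus xp (scal 2 x)) xm)) (grad phi x).

Definition discrete_euler_lagrange (L : R * R -> R * R -> R -> R)
    (xm x xp : R * R) (h : R) : R * R :=
  plus (grad (fun u => L u xp h) x) (grad (fun u => L xm u h) x).

Definition split_lagrangian (phi1 phi2 : R * R -> R) (a b : R * R) (h : R) : R :=
  / 2 * (enorm (minus b a) ^ 2 / h ^ 2)
  - (phi1 (fst b, snd a) + phi2 (fst b, snd b)).

(** [om] is a continuous polar angle of the LRL vector along [(x, v)]. *)
Definition lrl_angle (T : R) (x v : R -> R * R) (om : R -> R) : Prop :=
  forall t, 0 <= t <= T ->
    filterlim om (within (fun s => 0 <= s <= T) (locally t)) (locally (om t)) /\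
    lrl (x t) (v t) = scal (enorm (lrl (x t) (v t))) (cos (om t), sin (om t)).

Definition lrl_norm_error_order (p : nat)
    (f : nat -> (R * R) * (R * R) -> R * R) (K : nat) (x0 v0 : R * R) (T : R)
    : Prop :=
  exists C h0, 0 < h0 /\ forall h, 0 < h < h0 ->
    forall x v : R -> R * R,
      solves (truncation f K h) (fun t => 0 <= t <= T) x v ->
      x 0 = x0 -> v 0 = v0 ->
      Rabs (enorm (lrl (x T) (v T)) - enorm (lrl (x 0) (v 0))) <= C * h ^ p.

Definition lrl_angle_error_order (p : nat)
    (f : nat -> (R * R) * (R * R) -> R * R) (K : nat) (x0 v0 : R * R) (T : R)
    : Prop :=
  exists C h0, 0 < h0 /\ forall h, 0 < h < h0 ->
    forall x v : R -> R * R,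
      solves (truncation f K h) (fun t => 0 <= t <= T) x v ->
      x 0 = x0 -> v 0 = v0 ->
      forall om : R -> R, lrl_angle T x v om ->
      Rabs (om T - om 0) <= C * h ^ p.

(* Main.v *)
Require Import Defs.
From Stdlib Require Import Reals Lra Lia Classical.
From Coquelicot Require Import Coquelicot.
Open Scope R_scope.

(** Write the truncated modified equation as the Kepler equation plus a force
    [h f1 + O(h^2)]. The LRL vector [A] is conserved by the Kepler flow, so
    along the perturbed solution it moves at the rate [h D(x, v) + O(h^2)],
    where [D] is linear in [f1]. The theorem says that the contribution of [D]
    vanishes to first order after one period.

    The term [f1] is found by comparing orders of [h] in the difference
    equation ([order_one_identified]). The symplectic Euler method is, as a
    method in position, symmetric in time, and [f1 = 0]
    ([symplectic_euler_magnetic]). For the splitting with equal halves the two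
    mixed evaluation points produce [f1 = b(x) (v2, - v1)], where [b] is half
    the mixed second derivative of [phi] ([split_lagrangian_magnetic]), a
    magnetic force orthogonal to the velocity. Both cases are treated at once,
    with a factor [c] equal to 0 or 1 in front of this force.

    For the magnetic force, let [u = x / r] have polar angle [a]. Both [x] and
    [v] are expressed by [u] and the conserved quantities [L] and [A], because
    [v = (- A2 - u2, A1 + u1) / L], and [dt = (r^2 / L) da]. All powers of [r]
    cancel in [D dt], which becomes a trigonometric polynomial in [a] with
    conserved coefficients. Its mean value is zero, hence [D] is the derivative
    along the Kepler flow of a single-valued function [(Q1, Q2)] of the state.
    Along the perturbed solution [A - h c Q] therefore moves at the rate
    [O(h^2)] ([Q1_forced_rate], [Q2_forced_rate]). By Gronwall's inequality
    the perturbed solution stays within [O(h)] of the periodic orbit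
    ([orbit_shadowed]), so that [Q] returns to its initial value up to [O(h)],
    and [A] to its own up to [O(h^2)] ([drift_over_period]).

    The division by [L] is legitimate: with [L = 0] the radial velocity of a
    periodic orbit would be strictly decreasing ([orbit_angmom]). Since the
    orbit is not circular [A] is not zero ([orbit_eccentric]), and a continuous
    polar angle of a vector that stays near [A] cannot wind around the origin
    ([angle_small]), so that the bound on [A] gives one on the angle. *)

(** * Real analysis on an interval *)

(** Connectedness of [[0, a]] as an induction principle: all the arguments of
    the form as long as the solution has stayed close, it stays close are
    instances of it. *)
Lemma real_induction (P : R -> Prop) (a : R) :
  0 <= a -> P 0 ->
  (forall t, 0 <= t <= a -> exists d, 0 < d /\
     forall u w, t - d < u -> u <= w -> w < t + d -> 0 <= u -> w <= a ->
       P u -> P w) ->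
  P a.
Proof.
intros Ha P0 Hloc.
set (E := fun t => 0 <= t <= a /\ P t).
destruct (completeness E) as [m [Hub Hlub]].
{ exists a. intros t [Ht _]. lra. }
{ exists 0. split; [lra | exact P0]. }
assert (Hm : 0 <= m <= a).
{ split.
  - apply Hub. split; [lra | exact P0].
  - apply Hlub. intros t [Ht _]. lra. }
destruct (Hloc m Hm) as [d [Hd Hstep]].
assert (Hu : exists u, m - d < u /\ E u).
{ apply NNPP. intro HN.
  assert (m <= m - d); [| lra].
  apply Hlub. intros t Et.
  destruct (Rle_lt_dec t (m - d)) as [H | H]; [exact H |].
  exfalso. apply HN. exists t. split; assumption. }
destruct Hu as [u [Hu1 [Hu2 Pu]]].
assert (Hum : u <= m) by (apply Hub; split; assumption).
destruct (Rle_lt_dec (m + d / 2) a) as [H | H].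
- assert (m + d / 2 <= m); [| lra].
  apply Hub. split; [lra |]. apply (Hstep u); try lra. exact Pu.
- apply (Hstep u); try lra. exact Pu.
Qed.

Lemma derivable_continuous_at (f : R -> R) (t l : R) :
  is_derive f t l -> continuity_pt f t.
Proof.
intro H. apply continuity_pt_filterlim.
apply (ex_derive_continuous f t). exists l. exact H.
Qed.

Lemma mean_value_bound (u du : R -> R) (a c : R) :
  0 <= a ->
  (forall t, 0 <= t <= a -> is_derive u t (du t)) ->
  (forall t, 0 <= t <= a -> Rabs (du t) <= c) ->
  Rabs (u a - u 0) <= c * a.
Proof.
intros Ha Hd Hc.
destruct (MVT_gen u 0 a du) as [xi [Hxi Heq]];
  rewrite ?(Rmin_left 0 a), ?(Rmax_right 0 a) in * by lra.
- intros t Ht. apply Hd. lra.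
- intros t Ht. apply (derivable_continuous_at _ _ (du t)). apply Hd. lra.
- rewrite Heq, Rabs_mult, (Rabs_pos_eq (a - 0)) by lra.
  rewrite Rminus_0_r. apply Rmult_le_compat_r; [exact Ha |].
  apply Hc. lra.
Qed.

Lemma gronwall (E dE : R -> R) (a k m : R) :
  0 <= a -> 0 <= k -> 0 <= m ->
  (forall t, 0 <= t <= a -> is_derive E t (dE t)) ->
  E 0 = 0 ->
  (forall t, 0 <= t <= a -> dE t <= k * E t + m) ->
  E a <= m * a * exp (k * a).
Proof.
intros Ha Hk Hm HE E0 Hle.
set (u := fun t => E t * exp (- k * t) - m * t).
set (du := fun t => (dE t - k * E t) * exp (- k * t) - m).
assert (Hu : forall t, 0 <= t <= a -> is_derive u t (du t)).
{ intros t Ht. unfold u, du.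
  specialize (HE t Ht).
  auto_derive.
  - exists (dE t). exact HE.
  - replace (Derive (fun x => E x) t) with (dE t)
      by (symmetry; apply is_derive_unique; exact HE).
    ring. }
destruct (MVT_gen u 0 a du) as [xi [Hxi Heq]];
  rewrite ?(Rmin_left 0 a), ?(Rmax_right 0 a) in * by lra.
- intros t Ht. apply Hu. lra.
- intros t Ht. apply (derivable_continuous_at _ _ (du t)). apply Hu. lra.
- assert (Hneg : du xi <= 0).
  { unfold du. specialize (Hle xi Hxi).
    assert (He : 0 < exp (- k * xi)) by apply exp_pos.
    assert (He1 : exp (- k * xi) <= 1).
    { rewrite <- exp_0.
      assert (Hx : - k * xi <= 0) by nra.
      destruct Hx as [Hx | Hx]; [left; apply exp_increasing, Hx |].
      rewrite Hx. lra. }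
    nra. }
  assert (Hua : u a <= 0).
  { assert (u 0 = 0) by (unfold u; rewrite E0; ring). nra. }
  unfold u in Hua.
  assert (Hinv : exp (- k * a) * exp (k * a) = 1).
  { rewrite <- exp_plus. replace (- k * a + k * a) with 0 by ring.
    apply exp_0. }
  assert (Hp : 0 < exp (k * a)) by apply exp_pos.
  replace (E a) with (E a * exp (- k * a) * exp (k * a))
    by (rewrite Rmult_assoc, Hinv; ring).
  apply Rmult_le_compat_r; lra.
Qed.

(** The differential inequality is only known while [E < d]; the bound that
    it yields is itself below [d], so that [E] never reaches [d]. *)
Lemma gronwall_confined (E dE : R -> R) (a d k m : R) :
  0 <= a -> 0 <= k -> 0 <= m ->
  (forall t, 0 <= t <= a -> is_derive E t (dE t)) ->
  E 0 = 0 ->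
  (forall t, 0 <= t <= a -> E t < d -> dE t <= k * E t + m) ->
  m * a * exp (k * a) < d ->
  forall t, 0 <= t <= a -> E t <= m * a * exp (k * a).
Proof.
intros Ha Hk Hm HE E0 Hle Hd.
set (B := m * a * exp (k * a)) in *.
assert (HB : 0 <= B).
{ unfold B. assert (0 < exp (k * a)) by apply exp_pos. 
  assert (0 <= m * a) by nra. nra. }
assert (Hmono : forall t, 0 <= t <= a -> m * t * exp (k * t) <= B).
{ intros t Ht. unfold B.
  apply Rmult_le_compat; [nra | left; apply exp_pos | nra |].
  assert (Hx : k * t <= k * a) by nra.
  destruct Hx as [Hx | Hx]; [left; apply exp_increasing, Hx |].
  rewrite Hx. lra. }
assert (Hall : forall t, 0 <= t <= a -> E t <= B); [| exact Hall].
apply (real_induction (fun b => forall t, 0 <= t <= b -> E t <= B) a Ha).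
- intros t Ht. replace t with 0 by lra. lra.
- intros t Ht.
  assert (Hc : continuity_pt E t)
    by (apply (derivable_continuous_at _ _ (dE t)); apply HE; lra).
  destruct (Hc ((d - B) / 2)) as [del [Hdel Hcl]]; [lra |].
  assert (Hclose : forall s, Rabs (s - t) < del ->
            Rabs (E s - E t) < (d - B) / 2).
  { intros s Hs. destruct (Req_dec s t) as [-> | Hne].
    - unfold Rminus. rewrite Rplus_opp_r, Rabs_R0. lra.
    - apply (Hcl s). split; [split; [exact I | auto] | exact Hs]. }
  exists del. split; [exact Hdel |].
  intros u w Hu Huw Hw Hu0 Hwa IH.
  assert (HEu : E u <= B) by (apply IH; lra).
  assert (Hbelow : forall s, 0 <= s <= w -> E s < d).
  { intros s Hs. destruct (Rle_lt_dec s u) as [Hsu | Hsu].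
    - assert (E s <= B) by (apply IH; lra). lra.
    - assert (H1 := Hclose s ltac:(apply Rabs_def1; lra)).
      assert (H2 := Hclose u ltac:(apply Rabs_def1; lra)).
      apply Rabs_def2 in H1. apply Rabs_def2 in H2. lra. }
  intros s Hs.
  apply Rle_trans with (m * s * exp (k * s)); [| apply Hmono; lra].
  apply gronwall with dE; try lra.
  + intros r Hr. apply HE. lra.
  + intros r Hr. apply Hle; [lra |]. apply Hbelow. lra.
Qed.

(** * Locally Lipschitz functions of the state *)

Notation state := ((R * R) * (R * R))%type.

Definition X1 (s : state) := fst (fst s).
Definition X2 (s : state) := snd (fst s).
Definition V1 (s : state) := fst (snd s).
Definition V2 (s : state) := snd (snd s).

(** Equivalent to the distance of the product uniform space; a sum is the form
    in which Lipschitz bounds are added up. *)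
Definition sdist (s s' : state) : R :=
  Rabs (X1 s - X1 s') + Rabs (X2 s - X2 s')
  + Rabs (V1 s - V1 s') + Rabs (V2 s - V2 s').

Lemma ball_state (s s' : state) (d : R) :
  ball s d s' <->
  Rabs (X1 s' - X1 s) < d /\ Rabs (X2 s' - X2 s) < d /\
  Rabs (V1 s' - V1 s) < d /\ Rabs (V2 s' - V2 s) < d.
Proof.
destruct s as [[a b] [c e]], s' as [[a' b'] [c' e']].
split.
- intros [[H1 H2] [H3 H4]]. repeat split; assumption.
- intros [H1 [H2 [H3 H4]]]. repeat split; assumption.
Qed.

Lemma sdist_nonneg s s' : 0 <= sdist s s'.
Proof.
unfold sdist.
assert (H1 := Rabs_pos (X1 s - X1 s')). assert (H2 := Rabs_pos (X2 s - X2 s')).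
assert (H3 := Rabs_pos (V1 s - V1 s')). assert (H4 := Rabs_pos (V2 s - V2 s')).
lra.
Qed.

Lemma sdist_center s0 d s : ball s0 d s -> sdist s s0 < 4 * d.
Proof. intros H. apply ball_state in H. unfold sdist. lra. Qed.

Lemma ball_state_le (s0 s : state) (d e : R) :
  d <= e -> ball s0 d s -> ball s0 e s.
Proof. intros H Hb. apply ball_state in Hb. apply ball_state. lra. Qed.

Lemma ball_state_center (s : state) (d : R) : 0 < d -> ball s d s.
Proof. intros Hd. apply ball_state. unfold Rminus. rewrite !Rplus_opp_r, !Rabs_R0. lra. Qed.

(** One notion that implies continuity and local boundedness at [s0], a
    first-order bound on increments, and the Lipschitz estimate of Gronwall's
    argument; it is stable under all the operations that occur. *)
Definition loc_lip (G : state -> R) (s0 : state) : Prop :=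
  exists M d, 0 < d /\ 0 <= M /\ forall s s',
    ball s0 d s -> ball s0 d s' -> Rabs (G s - G s') <= M * sdist s s'.

Lemma loc_lip_bounded G s0 : loc_lip G s0 ->
  exists M d, 0 < d /\ 0 <= M /\ forall s, ball s0 d s -> Rabs (G s) <= M.
Proof.
intros [M [d [Hd [HM H]]]].
exists (Rabs (G s0) + M * (4 * d)), d.
assert (Hp := Rabs_pos (G s0)).
split; [exact Hd |]. split; [nra |]. intros s Hs.
assert (H1 := H s s0 Hs (ball_state_center s0 d Hd)).
assert (H2 := sdist_center _ _ _ Hs).
assert (H3 := Rabs_triang (G s - G s0) (G s0)).
replace (G s - G s0 + G s0) with (G s) in H3 by ring.
nra.
Qed.

(** A continuity statement with an explicit radius, in the form in which
    trajectories are controlled. *)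
Lemma loc_lip_close G s0 eps : loc_lip G s0 -> 0 < eps ->
  exists d, 0 < d /\ forall s, ball s0 d s -> Rabs (G s - G s0) <= eps.
Proof.
intros [M [d [Hd [HM H]]]] He.
assert (Hq : 0 < eps / (4 * (M + 1))) by (apply Rdiv_lt_0_compat; lra).
exists (Rmin d (eps / (4 * (M + 1)))).
split; [apply Rmin_pos; assumption |].
intros s Hs.
assert (Hs1 : ball s0 d s) by (eapply ball_state_le; [apply Rmin_l | exact Hs]).
assert (H2 := sdist_center _ _ _ (ball_state_le _ _ _ _ (Rmin_r _ _) Hs)).
assert (H1 := H s s0 Hs1 (ball_state_center s0 d Hd)).
assert (H3 := sdist_nonneg s s0).
apply Rle_trans with (1 := H1).
apply Rle_trans with ((M + 1) * (4 * (eps / (4 * (M + 1))))).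
- nra.
- right. field. lra.
Qed.

Lemma loc_lip_continuous G s0 : loc_lip G s0 -> continuous G s0.
Proof.
intros HG P [e He].
destruct (loc_lip_close _ _ (e / 2) HG ltac:(assert (h := cond_pos e); lra))
  as [d [Hd H]].
exists (mkposreal d Hd). intros s Hs. apply He.
change (Rabs (G s - G s0) < e). specialize (H s Hs).
assert (h := cond_pos e). lra.
Qed.

Lemma loc_lip_const c s0 : loc_lip (fun _ => c) s0.
Proof.
exists 0, 1. split; [lra |]. split; [lra |]. intros s s' _ _.
unfold Rminus. rewrite Rplus_opp_r, Rabs_R0, Rmult_0_l. lra.
Qed.

Lemma loc_lip_coord (G : state -> R) s0 :
  (forall s s', Rabs (G s - G s') <= sdist s s') -> loc_lip G s0.
Proof.
intro H. exists 1, 1. split; [lra |]. split; [lra |].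
intros s s' _ _. rewrite Rmult_1_l. apply H.
Qed.

Ltac sdist_coord :=
  apply loc_lip_coord; intros s s'; unfold sdist;
  assert (H1 := Rabs_pos (X1 s - X1 s')); assert (H2 := Rabs_pos (X2 s - X2 s'));
  assert (H3 := Rabs_pos (V1 s - V1 s')); assert (H4 := Rabs_pos (V2 s - V2 s'));
  lra.

Lemma loc_lip_X1 s0 : loc_lip X1 s0. Proof. sdist_coord. Qed.
Lemma loc_lip_X2 s0 : loc_lip X2 s0. Proof. sdist_coord. Qed.
Lemma loc_lip_V1 s0 : loc_lip V1 s0. Proof. sdist_coord. Qed.
Lemma loc_lip_V2 s0 : loc_lip V2 s0. Proof. sdist_coord. Qed.

Lemma loc_lip_plus G K s0 :
  loc_lip G s0 -> loc_lip K s0 -> loc_lip (fun s => G s + K s) s0.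
Proof.
intros [M [d [Hd [HM H]]]] [M' [d' [Hd' [HM' H']]]].
exists (M + M'), (Rmin d d').
split; [apply Rmin_pos; assumption |]. split; [lra |].
intros s s' Hs Hs'.
assert (h1 := H s s' (ball_state_le _ _ _ _ (Rmin_l _ _) Hs)
              (ball_state_le _ _ _ _ (Rmin_l _ _) Hs')).
assert (h2 := H' s s' (ball_state_le _ _ _ _ (Rmin_r _ _) Hs)
              (ball_state_le _ _ _ _ (Rmin_r _ _) Hs')).
replace (G s + K s - (G s' + K s')) with ((G s - G s') + (K s - K s')) by ring.
assert (h3 := Rabs_triang (G s - G s') (K s - K s')).
lra.
Qed.

Lemma loc_lip_mult G K s0 :
  loc_lip G s0 -> loc_lip K s0 -> loc_lip (fun s => G s * K s) s0.
Proof.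
intros HG HK.
destruct (loc_lip_bounded _ _ HG) as [B [b [Hb [HB BG]]]].
destruct (loc_lip_bounded _ _ HK) as [B' [b' [Hb' [HB' BK]]]].
destruct HG as [M [d [Hd [HM H]]]]. destruct HK as [M' [d' [Hd' [HM' H']]]].
exists (M * B' + B * M'), (Rmin (Rmin d d') (Rmin b b')).
split; [repeat apply Rmin_pos; assumption |]. split; [nra |].
assert (Hdd : Rmin (Rmin d d') (Rmin b b') <= d /\
  Rmin (Rmin d d') (Rmin b b') <= d' /\
  Rmin (Rmin d d') (Rmin b b') <= b /\
  Rmin (Rmin d d') (Rmin b b') <= b').
{ assert (A1 := Rmin_l (Rmin d d') (Rmin b b')).
  assert (A2 := Rmin_r (Rmin d d') (Rmin b b')).
  assert (A3 := Rmin_l d d'). assert (A4 := Rmin_r d d').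
  assert (A5 := Rmin_l b b'). assert (A6 := Rmin_r b b'). lra. }
destruct Hdd as [D1 [D2 [D3 D4]]].
intros s s' Hs Hs'.
assert (h1 := H s s' (ball_state_le _ _ _ _ D1 Hs) (ball_state_le _ _ _ _ D1 Hs')).
assert (h2 := H' s s' (ball_state_le _ _ _ _ D2 Hs) (ball_state_le _ _ _ _ D2 Hs')).
assert (h3 := BG s' (ball_state_le _ _ _ _ D3 Hs')).
assert (h4 := BK s (ball_state_le _ _ _ _ D4 Hs)).
replace (G s * K s - G s' * K s')
  with ((G s - G s') * K s + G s' * (K s - K s')) by ring.
apply Rle_trans with (1 := Rabs_triang _ _). rewrite !Rabs_mult.
assert (P1 := Rabs_pos (G s - G s')). assert (P2 := Rabs_pos (K s)).
assert (P3 := Rabs_pos (G s')). assert (P4 := Rabs_pos (K s - K s')).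
assert (Q1 : Rabs (G s - G s') * Rabs (K s) <= M * sdist s s' * B')
  by (apply Rmult_le_compat; assumption).
assert (Q2 : Rabs (G s') * Rabs (K s - K s') <= B * (M' * sdist s s'))
  by (apply Rmult_le_compat; assumption).
lra.
Qed.

Lemma loc_lip_ext G K s0 : (forall s, G s = K s) -> loc_lip G s0 -> loc_lip K s0.
Proof.
intros He [M [d [Hd [HM H]]]]. exists M, d. split; [assumption|]. split; [assumption|].
intros s s'. rewrite <- !He. apply H.
Qed.

Lemma loc_lip_opp G s0 : loc_lip G s0 -> loc_lip (fun s => - G s) s0.
Proof.
intro H. apply loc_lip_ext with (fun s => (-1) * G s); [intro; ring |].
apply loc_lip_mult; [apply loc_lip_const | exact H].
Qed.

Lemma loc_lip_minus G K s0 :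
  loc_lip G s0 -> loc_lip K s0 -> loc_lip (fun s => G s - K s) s0.
Proof. intros H H'. apply loc_lip_plus; [exact H | apply loc_lip_opp, H']. Qed.

Lemma loc_lip_pow G s0 n : loc_lip G s0 -> loc_lip (fun s => G s ^ n) s0.
Proof.
intro H. induction n as [| n IH]; simpl.
- apply loc_lip_const.
- apply loc_lip_mult; assumption.
Qed.

Lemma loc_lip_comp (g : R -> R) (c e : R) G s0 :
  0 < e -> 0 <= c ->
  (forall u u', Rabs (u - G s0) <= e -> Rabs (u' - G s0) <= e ->
     Rabs (g u - g u') <= c * Rabs (u - u')) ->
  loc_lip G s0 -> loc_lip (fun s => g (G s)) s0.
Proof.
intros He Hc Hg HG.
destruct (loc_lip_close _ _ e HG He) as [b [Hb Hclose]].
destruct HG as [M [d [Hd [HM H]]]].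
exists (c * M), (Rmin d b). split; [apply Rmin_pos; assumption |].
split; [nra |]. intros s s' Hs Hs'.
assert (h := H s s' (ball_state_le _ _ _ _ (Rmin_l _ _) Hs)
              (ball_state_le _ _ _ _ (Rmin_l _ _) Hs')).
assert (h1 := Hclose s (ball_state_le _ _ _ _ (Rmin_r _ _) Hs)).
assert (h2 := Hclose s' (ball_state_le _ _ _ _ (Rmin_r _ _) Hs')).
apply Rle_trans with (1 := Hg _ _ h1 h2). rewrite Rmult_assoc.
apply Rmult_le_compat_l; assumption.
Qed.

Lemma loc_lip_inv G s0 : G s0 <> 0 -> loc_lip G s0 -> loc_lip (fun s => / G s) s0.
Proof.
intros H0 HG.
set (q := Rabs (G s0)). assert (Hq : 0 < q) by (apply Rabs_pos_lt, H0).
apply (loc_lip_comp Rinv (4 / (q * q)) (q / 2)); [lra | | | exact HG].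
- left. apply Rdiv_lt_0_compat; nra.
- assert (Hlow : forall u, Rabs (u - G s0) <= q / 2 -> q / 2 <= Rabs u).
  { intros u Hu. assert (h := Rabs_triang_inv (G s0) u).
    rewrite Rabs_minus_sym in h. fold q in h. lra. }
  intros u u' Hu Hu'.
  apply Hlow in Hu. apply Hlow in Hu'.
  assert (Hne : forall z, q / 2 <= Rabs z -> z <> 0).
  { intros z Hz ->. rewrite Rabs_R0 in Hz. lra. }
  replace (/ u - / u') with ((u' - u) * (/ u * / u'))
    by (field; split; apply Hne; assumption).
  rewrite Rabs_mult, (Rabs_minus_sym u' u), Rmult_comm.
  apply Rmult_le_compat_r; [apply Rabs_pos |].
  rewrite Rabs_mult, !Rabs_inv.
  replace (4 / (q * q)) with (/ (q / 2) * / (q / 2)) by (field; lra).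
  apply Rmult_le_compat;
    try (left; apply Rinv_0_lt_compat; lra); apply Rinv_le_contravar; lra.
Qed.

Lemma loc_lip_div G K s0 : K s0 <> 0 ->
  loc_lip G s0 -> loc_lip K s0 -> loc_lip (fun s => G s / K s) s0.
Proof. intros H HG HK. apply loc_lip_mult; [exact HG | apply loc_lip_inv; assumption]. Qed.

Lemma loc_lip_sqrt G s0 : 0 < G s0 -> loc_lip G s0 -> loc_lip (fun s => sqrt (G s)) s0.
Proof.
intros H0 HG.
assert (Hs : 0 < sqrt (G s0 / 2)) by (apply sqrt_lt_R0; lra).
apply (loc_lip_comp sqrt (/ sqrt (G s0 / 2)) (G s0 / 2)); [lra | | | exact HG].
- left. apply Rinv_0_lt_compat, Hs.
- intros u u' Hu Hu'.
  assert (h : G s0 / 2 <= u) by (apply Rabs_le_between in Hu; lra).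
  assert (h' : G s0 / 2 <= u') by (apply Rabs_le_between in Hu'; lra).
  assert (k := sqrt_le_1_alt _ _ h). assert (k' := sqrt_le_1_alt _ _ h').
  assert (Heq : u - u' = (sqrt u - sqrt u') * (sqrt u + sqrt u')).
  { assert (e1 := sqrt_sqrt u ltac:(lra)). assert (e2 := sqrt_sqrt u' ltac:(lra)). nra. }
  rewrite Heq, Rabs_mult, (Rabs_pos_eq (sqrt u + sqrt u')) by lra.
  assert (P := Rabs_pos (sqrt u - sqrt u')).
  apply Rmult_le_reg_l with (sqrt (G s0 / 2)); [exact Hs |].
  rewrite <- Rmult_assoc, Rinv_r, Rmult_1_l by lra. nra.
Qed.

(** * Kepler quantities as functions of the state *)

Definition rad (s : state) : R := sqrt (X1 s ^ 2 + X2 s ^ 2).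
Definition angmom (s : state) : R := X1 s * V2 s - X2 s * V1 s.
Definition radvel (s : state) : R := (X1 s * V1 s + X2 s * V2 s) / rad s.
Definition u1 (s : state) : R := X1 s / rad s.
Definition u2 (s : state) : R := X2 s / rad s.
Definition ecc1 (s : state) : R := V2 s * angmom s - u1 s.
Definition ecc2 (s : state) : R := - (V1 s * angmom s) - u2 s.
Definition grav1 (s : state) : R := - (X1 s / rad s ^ 3).
Definition grav2 (s : state) : R := - (X2 s / rad s ^ 3).
Definition cross (s : state) : R := X1 s * X2 s / rad s ^ 5.

Lemma enorm_fst s : enorm (fst s) = rad s.
Proof. reflexivity. Qed.

Lemma enorm_sq a : enorm a ^ 2 = fst a ^ 2 + snd a ^ 2.
Proof. unfold enorm. apply pow2_sqrt. nra. Qed.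

Lemma sumsq_pos a : a <> (0, 0) -> 0 < fst a ^ 2 + snd a ^ 2.
Proof.
destruct a as [p q]. simpl. intro H.
destruct (Req_dec p 0) as [-> | Hp]; [| assert (0 < p * p) by nra; nra].
destruct (Req_dec q 0) as [-> | Hq]; [congruence |].
assert (0 < q * q) by nra. nra.
Qed.

Lemma nonzero_of_sumsq (a : R * R) : 0 < fst a ^ 2 + snd a ^ 2 -> a <> (0, 0).
Proof. intros H ->. simpl in H. lra. Qed.

Lemma rad_pos s : fst s <> (0, 0) -> 0 < rad s.
Proof. intro H. apply sqrt_lt_R0, sumsq_pos, H. Qed.

Lemma rad_sq s : rad s ^ 2 = X1 s ^ 2 + X2 s ^ 2.
Proof. apply (enorm_sq (fst s)). Qed.

Lemma lrl_state s : lrl (fst s) (snd s) = (ecc1 s, ecc2 s).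
Proof.
unfold lrl. rewrite enorm_fst, enorm_sq.
unfold ecc1, ecc2, u1, u2, angmom, dot, X1, X2, V1, V2, Rdiv.
f_equal; ring.
Qed.

Lemma lrl_pair x v : lrl x v = (ecc1 (x, v), ecc2 (x, v)).
Proof. apply (lrl_state (x, v)). Qed.

(** In the plane [x . A = L^2 - r], the focal equation of the conic. *)
Lemma focal_equation s : fst s <> (0, 0) ->
  X1 s * ecc1 s + X2 s * ecc2 s = angmom s ^ 2 - rad s.
Proof.
intro H. assert (Hr := rad_pos s H).
unfold ecc1, ecc2, u1, u2.
replace (rad s) with (rad s ^ 2 / rad s) at 3 by (field; lra).
rewrite rad_sq. unfold angmom. field. lra.
Qed.

(** ** Rates of change along a trajectory *)

Definition moves (s : R -> state) (t a1 a2 : R) : Prop :=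
  is_derive (fun t => X1 (s t)) t (V1 (s t)) /\
  is_derive (fun t => X2 (s t)) t (V2 (s t)) /\
  is_derive (fun t => V1 (s t)) t a1 /\
  is_derive (fun t => V2 (s t)) t a2.

Lemma is_derive_fst (g : R -> R * R) t l : is_derive g t l ->
  is_derive (fun t => fst (g t)) t (fst l).
Proof.
intro H.
exact (filterdiff_comp' g (fun p : R * R => fst p) t (fun y => scal y l)
         (fun p => fst p) H (filterdiff_linear _ is_linear_fst)).
Qed.

Lemma is_derive_snd (g : R -> R * R) t l : is_derive g t l ->
  is_derive (fun t => snd (g t)) t (snd l).
Proof.
intro H.
exact (filterdiff_comp' g (fun p : R * R => snd p) t (fun y => scal y l)
         (fun p => snd p) H (filterdiff_linear _ is_linear_snd)).
Qed.

Lemma solves_moves F I x v t : solves F I x v -> I t ->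
  x t <> (0, 0) /\
  moves (fun t => (x t, v t)) t (fst (F (x t, v t))) (snd (F (x t, v t))).
Proof.
intros H Ht. destruct (H t Ht) as [H0 [Hx Hv]].
split; [exact H0 |].
split; [| split; [| split]].
- apply (is_derive_fst x t (v t) Hx).
- apply (is_derive_snd x t (v t) Hx).
- apply (is_derive_fst v t _ Hv).
- apply (is_derive_snd v t _ Hv).
Qed.


Lemma is_derive_value (f : R -> R) (t l l' : R) : is_derive f t l -> l = l' -> is_derive f t l'.
Proof. intros H <-. exact H. Qed.

Lemma rate_plus (f g : R -> R) (t a b : R) : is_derive f t a -> is_derive g t b ->
  is_derive (fun t => f t + g t) t (a + b).
Proof. intros Hf Hg. exact (is_derive_plus f g t a b Hf Hg). Qed.

Lemma rate_minus (f g : R -> R) (t a b : R) : is_derive f t a -> is_derive g t b ->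
  is_derive (fun t => f t - g t) t (a - b).
Proof. intros Hf Hg. exact (is_derive_minus f g t a b Hf Hg). Qed.

Lemma rate_opp (f : R -> R) (t a : R) : is_derive f t a ->
  is_derive (fun t => - f t) t (- a).
Proof. intros Hf. exact (is_derive_opp f t a Hf). Qed.

Lemma rate_mult (f g : R -> R) (t a b : R) : is_derive f t a -> is_derive g t b ->
  is_derive (fun t => f t * g t) t (a * g t + f t * b).
Proof. intros Hf Hg. exact (is_derive_mult f g t a b Hf Hg Rmult_comm). Qed.

Lemma rate_div (f g : R -> R) (t a b : R) : is_derive f t a -> is_derive g t b ->
  g t <> 0 -> is_derive (fun t => f t / g t) t ((a * g t - f t * b) / g t ^ 2).
Proof. intros Hf Hg H. exact (is_derive_div f g t a b Hf Hg H). Qed.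

Lemma rate_const (c t : R) : is_derive (fun _ : R => c) t 0.
Proof. exact (is_derive_const c t). Qed.

Lemma rate_id (t : R) : is_derive (fun t : R => t) t 1.
Proof. exact (is_derive_id t). Qed.

(** Proceeds by syntax, so that compositions such as [X1 (s t)] with known
    rates are kept as atoms. *)
Ltac rates :=
  lazymatch goal with
  | |- is_derive (fun t => @?f t + @?g t) _ _ => eapply (rate_plus f g); rates
  | |- is_derive (fun t => @?f t - @?g t) _ _ => eapply (rate_minus f g); rates
  | |- is_derive (fun t => - @?f t) _ _ => eapply (rate_opp f); rates
  | |- is_derive (fun t => @?f t * @?g t) _ _ => eapply (rate_mult f g); rates
  | |- is_derive (fun t => @?f t / @?g t) _ _ => eapply (rate_div f g); rates
  | |- is_derive (fun t => @?f t ^ ?n) _ _ => eapply (is_derive_pow f n); rates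
  | |- is_derive (fun t => t) _ _ => apply rate_id
  | |- is_derive (fun _ => ?c) _ _ => apply (rate_const c)
  | |- is_derive _ _ _ => eassumption
  | |- _ => idtac
  end.

Section Rates.

Variables (s : R -> state) (t a1 a2 : R).
Hypothesis Hs : moves s t a1 a2.

Lemma angmom_rate :
  is_derive (fun t => angmom (s t)) t (X1 (s t) * a2 - X2 (s t) * a1).
Proof using Hs.
destruct Hs as [D1 [D2 [D3 D4]]].
eapply is_derive_value; [unfold angmom; rates | cbv beta; ring].
Qed.

Hypothesis H0 : fst (s t) <> (0, 0).

Let r_pos : 0 < rad (s t). Proof. apply rad_pos, H0. Qed.

Lemma rad_rate : is_derive (fun t => rad (s t)) t (radvel (s t)).
Proof using Hs H0.
destruct Hs as [D1 [D2 _]].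
assert (D : is_derive (fun t => X1 (s t) ^ 2 + X2 (s t) ^ 2) t
              (2 * (X1 (s t) * V1 (s t) + X2 (s t) * V2 (s t)))).
{ eapply is_derive_value; [rates | simpl; ring]. }
eapply is_derive_value.
- apply (is_derive_comp sqrt _ t _ _ (is_derive_sqrt (fun x => x) _ _
    (is_derive_id _) (sumsq_pos _ H0)) D).
- change (sqrt (fst (fst (s t)) ^ 2 + snd (fst (s t)) ^ 2)) with (rad (s t)).
  unfold radvel, scal, one; simpl; unfold mult; simpl. field. lra.
Qed.

(** Kepler's second law: the polar angle of [x] grows at the rate [L / r^2]. *)
Lemma u1_rate :
  is_derive (fun t => u1 (s t)) t (- (u2 (s t) * (angmom (s t) / rad (s t) ^ 2))).
Proof using Hs H0.
assert (Dr := rad_rate). destruct Hs as [D1 [D2 _]].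
eapply is_derive_value; [unfold u1; rates; lra |].
unfold u2, radvel, angmom.
replace (V1 (s t) * rad (s t)) with (V1 (s t) * rad (s t) ^ 2 / rad (s t))
  by (field; lra).
rewrite rad_sq at 1. field. lra.
Qed.

Lemma u2_rate :
  is_derive (fun t => u2 (s t)) t (u1 (s t) * (angmom (s t) / rad (s t) ^ 2)).
Proof using Hs H0.
assert (Dr := rad_rate). destruct Hs as [D1 [D2 _]].
eapply is_derive_value; [unfold u2; rates; lra |].
unfold u1, radvel, angmom.
replace (V2 (s t) * rad (s t)) with (V2 (s t) * rad (s t) ^ 2 / rad (s t))
  by (field; lra).
rewrite rad_sq at 1. field. lra.
Qed.

Lemma grav1_rate :
  is_derive (fun t => grav1 (s t)) t
    (3 * X1 (s t) * (X1 (s t) * V1 (s t) + X2 (s t) * V2 (s t)) / rad (s t) ^ 5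
     - V1 (s t) / rad (s t) ^ 3).
Proof using Hs H0.
assert (Dr := rad_rate). destruct Hs as [D1 [D2 _]].
eapply is_derive_value; [unfold grav1; rates; apply pow_nonzero; lra |].
unfold radvel. simpl INR. simpl Init.Nat.pred. field. lra.
Qed.

Lemma grav2_rate :
  is_derive (fun t => grav2 (s t)) t
    (3 * X2 (s t) * (X1 (s t) * V1 (s t) + X2 (s t) * V2 (s t)) / rad (s t) ^ 5
     - V2 (s t) / rad (s t) ^ 3).
Proof using Hs H0.
assert (Dr := rad_rate). destruct Hs as [D1 [D2 _]].
eapply is_derive_value; [unfold grav2; rates; apply pow_nonzero; lra |].
unfold radvel. simpl INR. simpl Init.Nat.pred. field. lra.
Qed.

End Rates.

Section ForcedRates.

Variables (s : R -> state) (t g1 g2 : R).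
Hypothesis Hs : moves s t (grav1 (s t) + g1) (grav2 (s t) + g2).
Hypothesis H0 : fst (s t) <> (0, 0).

Let r_pos : 0 < rad (s t). Proof. apply rad_pos, H0. Qed.

(** Gravity being central, only the perturbing force exerts a torque. *)
Lemma angmom_forced_rate :
  is_derive (fun t => angmom (s t)) t (X1 (s t) * g2 - X2 (s t) * g1).
Proof using Hs H0.
eapply is_derive_value; [exact (angmom_rate _ _ _ _ Hs) |].
unfold grav1, grav2. field. lra.
Qed.

Lemma ecc1_forced_rate :
  is_derive (fun t => ecc1 (s t)) t
    (g2 * angmom (s t) + V2 (s t) * (X1 (s t) * g2 - X2 (s t) * g1)).
Proof using Hs H0.
assert (DL := angmom_forced_rate). assert (Du := u1_rate _ _ _ _ Hs H0).
destruct Hs as [_ [_ [_ D4]]].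
eapply is_derive_value; [unfold ecc1; rates |].
unfold grav2, u2. field. lra.
Qed.

Lemma ecc2_forced_rate :
  is_derive (fun t => ecc2 (s t)) t
    (- (g1 * angmom (s t) + V1 (s t) * (X1 (s t) * g2 - X2 (s t) * g1))).
Proof using Hs H0.
assert (DL := angmom_forced_rate). assert (Du := u2_rate _ _ _ _ Hs H0).
destruct Hs as [_ [_ [D3 _]]].
eapply is_derive_value; [unfold ecc2; rates |].
unfold grav1, u1. field. lra.
Qed.

Lemma radvel_rate :
  is_derive (fun t => radvel (s t)) t
    (angmom (s t) ^ 2 / rad (s t) ^ 3 - 1 / rad (s t) ^ 2
     + (X1 (s t) * g1 + X2 (s t) * g2) / rad (s t)).
Proof using Hs H0.
assert (Dr := rad_rate _ _ _ _ Hs H0). destruct Hs as [D1 [D2 [D3 D4]]].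
eapply is_derive_value; [unfold radvel; rates; lra |].
assert (Hr := rad_sq (s t)).
unfold radvel, angmom, grav1, grav2.
set (r := rad (s t)) in *. set (x := X1 (s t)) in *. set (y := X2 (s t)) in *.
set (v := V1 (s t)). set (w := V2 (s t)).
transitivity (((v ^ 2 + w ^ 2) * r ^ 2 - (x * v + y * w) ^ 2) / r ^ 3
  - (x ^ 2 + y ^ 2) / r ^ 4 + (x * g1 + y * g2) / r).
- field. lra.
- rewrite <- Hr at 1. rewrite Hr at 1. field. lra.
Qed.

End ForcedRates.

Lemma loc_lip_rad s0 : fst s0 <> (0, 0) -> loc_lip rad s0.
Proof.
intro H. unfold rad. apply loc_lip_sqrt; [apply sumsq_pos, H |].
apply loc_lip_plus; apply loc_lip_pow; [apply loc_lip_X1 | apply loc_lip_X2].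
Qed.

Ltac loc_lips :=
  lazymatch goal with
  | |- loc_lip X1 _ => apply loc_lip_X1
  | |- loc_lip X2 _ => apply loc_lip_X2
  | |- loc_lip V1 _ => apply loc_lip_V1
  | |- loc_lip V2 _ => apply loc_lip_V2
  | |- loc_lip rad _ => apply loc_lip_rad; assumption
  | |- loc_lip (fun s => @?f s + @?g s) _ => apply (loc_lip_plus f g); loc_lips
  | |- loc_lip (fun s => @?f s - @?g s) _ => apply (loc_lip_minus f g); loc_lips
  | |- loc_lip (fun s => - @?f s) _ => apply (loc_lip_opp f); loc_lips
  | |- loc_lip (fun s => @?f s * @?g s) _ => apply (loc_lip_mult f g); loc_lips
  | |- loc_lip (fun s => @?f s / @?g s) _ => apply (loc_lip_div f g); [| loc_lips | loc_lips]
  | |- loc_lip (fun s => @?f s ^ ?n) _ => apply (loc_lip_pow f); loc_lips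
  | |- loc_lip (fun _ => ?c) _ => apply (loc_lip_const c)
  | |- loc_lip (fun s => ?f s) _ => change (fun s => f s) with f; loc_lips
  | |- loc_lip _ _ => try assumption
  end.

Section KeplerLip.
Variable s0 : state.
Hypothesis H0 : fst s0 <> (0, 0).
Let r_pos := rad_pos s0 H0.
Let rn_pos n : rad s0 ^ n <> 0.
Proof. apply pow_nonzero. lra. Qed.

Lemma loc_lip_angmom : loc_lip angmom s0.
Proof using. unfold angmom. loc_lips. Qed.
Lemma loc_lip_u1 : loc_lip u1 s0.
Proof using H0. unfold u1. loc_lips. lra. Qed.
Lemma loc_lip_u2 : loc_lip u2 s0.
Proof using H0. unfold u2. loc_lips. lra. Qed.
Lemma loc_lip_ecc1 : loc_lip ecc1 s0.
Proof using H0.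
assert (H := loc_lip_angmom). assert (K := loc_lip_u1). unfold ecc1. loc_lips.
Qed.
Lemma loc_lip_ecc2 : loc_lip ecc2 s0.
Proof using H0.
assert (H := loc_lip_angmom). assert (K := loc_lip_u2). unfold ecc2. loc_lips.
Qed.
Lemma loc_lip_grav1 : loc_lip grav1 s0.
Proof using H0. unfold grav1. loc_lips. apply rn_pos. Qed.
Lemma loc_lip_grav2 : loc_lip grav2 s0.
Proof using H0. unfold grav2. loc_lips. apply rn_pos. Qed.
Lemma loc_lip_cross : loc_lip cross s0.
Proof using H0. unfold cross. loc_lips. apply rn_pos. Qed.
End KeplerLip.

(** * The averaged drift of the LRL vector *)

(** The magnetic force; [- 3 cross] is the mixed second derivative of
    [phi]. *)
Definition mag1 (s : state) : R := - (3 / 2 * cross s * V2 s).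
Definition mag2 (s : state) : R := 3 / 2 * cross s * V1 s.

Definition drift1 (s : state) (g1 g2 : R) : R :=
  g2 * angmom s + V2 s * (X1 s * g2 - X2 s * g1).
Definition drift2 (s : state) (g1 g2 : R) : R :=
  - (g1 * angmom s + V1 s * (X1 s * g2 - X2 s * g1)).

(** With [x = r (cos a, sin a)] the rate of the drift caused by [mag1, mag2],
    taken with respect to [a], is a trigonometric polynomial without constant
    term whose coefficients are conserved; [Q1] and [Q2] are its
    antiderivatives. *)
Definition Q1 (s : state) : R :=
  3 / (2 * angmom s ^ 3) *
  (- (u2 s ^ 3 / 3) - ecc2 s * u2 s ^ 2 + 2 / 3 * ecc1 s * ecc2 s * u1 s ^ 3
   + (ecc1 s ^ 2 - ecc2 s ^ 2) * u2 s ^ 3 / 3).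
Definition Q2 (s : state) : R :=
  3 / (2 * angmom s ^ 3) *
  (- (u1 s ^ 3 / 3) + ecc1 s * u2 s ^ 2 + 2 / 3 * ecc1 s * ecc2 s * u2 s ^ 3
   + (ecc2 s ^ 2 - ecc1 s ^ 2) * u1 s ^ 3 / 3).

(** What a perturbing force adds to the rates of [Q1] and [Q2], through the
    quantities that it ceases to conserve. *)
Definition slip1 (s : state) (g1 g2 : R) : R :=
  - (3 / angmom s * Q1 s * (X1 s * g2 - X2 s * g1))
  + 3 / (2 * angmom s ^ 3) *
    ((2 / 3 * ecc2 s * u1 s ^ 3 + 2 / 3 * ecc1 s * u2 s ^ 3) * drift1 s g1 g2
     + (- (u2 s ^ 2) + 2 / 3 * ecc1 s * u1 s ^ 3 - 2 / 3 * ecc2 s * u2 s ^ 3)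
       * drift2 s g1 g2).
Definition slip2 (s : state) (g1 g2 : R) : R :=
  - (3 / angmom s * Q2 s * (X1 s * g2 - X2 s * g1))
  + 3 / (2 * angmom s ^ 3) *
    ((u2 s ^ 2 + 2 / 3 * ecc2 s * u2 s ^ 3 - 2 / 3 * ecc1 s * u1 s ^ 3)
       * drift1 s g1 g2
     + (2 / 3 * ecc1 s * u2 s ^ 3 + 2 / 3 * ecc2 s * u1 s ^ 3) * drift2 s g1 g2).

Section DriftPrimitive.

Variables (s : R -> state) (t g1 g2 : R).
Hypothesis Hs : moves s t (grav1 (s t) + g1) (grav2 (s t) + g2).
Hypothesis H0 : fst (s t) <> (0, 0).
Hypothesis HL : angmom (s t) <> 0.

Lemma unit_vector s' : fst s' <> (0, 0) -> u2 s' ^ 2 = 1 - u1 s' ^ 2.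
Proof using.
intro H. assert (Hr := rad_pos s' H). assert (Hq := rad_sq s').
unfold u1, u2. field_simplify_eq; [| lra]. lra.
Qed.

(** The hodograph is a circle: the velocity is an affine function of the unit
    vector with conserved coefficients. *)
Lemma hodograph s' : fst s' <> (0, 0) -> angmom s' <> 0 ->
  V1 s' = - (ecc2 s' + u2 s') / angmom s' /\ V2 s' = (ecc1 s' + u1 s') / angmom s'.
Proof using. intros H HL'. unfold ecc1, ecc2. split; field; exact HL'. Qed.

Lemma cross_unit s' : fst s' <> (0, 0) ->
  cross s' = u1 s' * u2 s' / rad s' ^ 3 /\
  X1 s' = u1 s' * rad s' /\ X2 s' = u2 s' * rad s'.
Proof using.
intro H. assert (Hr := rad_pos s' H). unfold cross, u1, u2.
repeat split; field; lra.
Qed.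

Lemma Q1_forced_rate :
  is_derive (fun t => Q1 (s t)) t
    (drift1 (s t) (mag1 (s t)) (mag2 (s t)) + slip1 (s t) g1 g2).
Proof using Hs H0 HL.
assert (DL := angmom_forced_rate _ _ _ _ Hs H0).
assert (D1 := ecc1_forced_rate _ _ _ _ Hs H0).
assert (D2 := ecc2_forced_rate _ _ _ _ Hs H0).
assert (Du1 := u1_rate _ _ _ _ Hs H0).
assert (Du2 := u2_rate _ _ _ _ Hs H0).
assert (Hr := rad_pos _ H0).
eapply is_derive_value.
- unfold Q1. rates; try lra.
  apply Rmult_integral_contrapositive_currified; [lra |].
  apply pow_nonzero, HL.
- assert (HU := unit_vector _ H0).
  destruct (hodograph _ H0 HL) as [HV1 HV2].
  destruct (cross_unit _ H0) as [Hc [HX1 HX2]].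
  simpl INR. simpl Init.Nat.pred.
  fold (drift1 (s t) g1 g2). fold (drift2 (s t) g1 g2).
  unfold slip1, Q1.
  generalize (drift1 (s t) g1 g2) (drift2 (s t) g1 g2).
  generalize (X1 (s t) * g2 - X2 (s t) * g1).
  (* one factor [L] has to be expanded for [r] to cancel *)
  change (drift1 (s t) (mag1 (s t)) (mag2 (s t))) with
    (mag2 (s t) * (X1 (s t) * V2 (s t) - X2 (s t) * V1 (s t))
     + V2 (s t) * (X1 (s t) * mag2 (s t) - X2 (s t) * mag1 (s t))).
  unfold mag1, mag2. rewrite Hc, HX1, HX2, HV1, HV2.
  revert HU HL Hr. 
  generalize (angmom (s t)) (ecc1 (s t)) (ecc2 (s t)) (u1 (s t)) (u2 (s t)) (rad (s t)).
  clear. intros L a1 a2 c d r HU HL Hr lam p q.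
  field_simplify_eq; [| split; lra]. ring [HU].
Qed.

Lemma Q2_forced_rate :
  is_derive (fun t => Q2 (s t)) t
    (drift2 (s t) (mag1 (s t)) (mag2 (s t)) + slip2 (s t) g1 g2).
Proof using Hs H0 HL.
assert (DL := angmom_forced_rate _ _ _ _ Hs H0).
assert (D1 := ecc1_forced_rate _ _ _ _ Hs H0).
assert (D2 := ecc2_forced_rate _ _ _ _ Hs H0).
assert (Du1 := u1_rate _ _ _ _ Hs H0).
assert (Du2 := u2_rate _ _ _ _ Hs H0).
assert (Hr := rad_pos _ H0).
eapply is_derive_value.
- unfold Q2. rates; try lra.
  apply Rmult_integral_contrapositive_currified; [lra |].
  apply pow_nonzero, HL.
- assert (HU := unit_vector _ H0).
  destruct (hodograph _ H0 HL) as [HV1 HV2].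
  destruct (cross_unit _ H0) as [Hc [HX1 HX2]].
  simpl INR. simpl Init.Nat.pred.
  fold (drift1 (s t) g1 g2). fold (drift2 (s t) g1 g2).
  unfold slip2, Q2.
  generalize (drift1 (s t) g1 g2) (drift2 (s t) g1 g2).
  generalize (X1 (s t) * g2 - X2 (s t) * g1).
  change (drift2 (s t) (mag1 (s t)) (mag2 (s t))) with
    (- (mag1 (s t) * (X1 (s t) * V2 (s t) - X2 (s t) * V1 (s t))
     + V1 (s t) * (X1 (s t) * mag2 (s t) - X2 (s t) * mag1 (s t)))).
  unfold mag1, mag2. rewrite Hc, HX1, HX2, HV1, HV2.
  revert HU HL Hr. 
  generalize (angmom (s t)) (ecc1 (s t)) (ecc2 (s t)) (u1 (s t)) (u2 (s t)) (rad (s t)).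
  clear. intros L a1 a2 c d r HU HL Hr lam p q.
  field_simplify_eq; [| split; lra]. ring [HU].
Qed.

End DriftPrimitive.

(** * Uniform bounds near the exact orbit *)

Section Tube.

Variables (z : R -> state) (T : R).
Hypothesis HT : 0 <= T.
Hypothesis z_cont : forall t d, 0 <= t <= T -> 0 < d ->
  exists e, 0 < e /\ forall t', Rabs (t' - t) < e -> ball (z t) d (z t').

(** Compactness of the arc: local constants near each of its points combine to
    one constant in one tube. *)
Lemma tube_uniform (Th : R -> state -> state -> Prop) :
  (forall M M' s s', M <= M' -> Th M s s' -> Th M' s s') ->
  (forall t, 0 <= t <= T -> exists M d, 0 < d /\
     forall s s', ball (z t) d s -> ball (z t) d s' -> Th M s s') ->
  exists M d, 0 < d /\ forall t, 0 <= t <= T ->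
    forall s s', ball (z t) d s -> ball (z t) d s' -> Th M s s'.
Proof using HT z_cont.
intros Hmono Hloc.
apply (real_induction (fun a => exists M d, 0 < d /\ forall t, 0 <= t <= a ->
    forall s s', ball (z t) d s -> ball (z t) d s' -> Th M s s') T HT).
- destruct (Hloc 0 ltac:(lra)) as [M [d [Hd H]]].
  exists M, d. split; [exact Hd |]. intros t Ht. replace t with 0 by lra. exact H.
- intros t Ht. destruct (Hloc t Ht) as [M [d [Hd H]]].
  destruct (z_cont t (d / 2) Ht ltac:(lra)) as [e [He Hz]].
  exists e. split; [exact He |].
  intros u w Hu Huw Hw Hu0 HwT [M' [d' [Hd' H']]].
  exists (Rmax M M'), (Rmin (d / 2) d').
  split; [apply Rmin_pos; lra |].
  intros r Hr s s' Hs Hs'.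
  destruct (Rle_lt_dec r u) as [Hru | Hru].
  + apply Hmono with M'; [apply Rmax_r |].
    apply (H' r ltac:(lra)); eapply ball_state_le; try eassumption; apply Rmin_r.
  + apply Hmono with M; [apply Rmax_l |].
    assert (Hb := Hz r ltac:(apply Rabs_def1; lra)).
    replace d with (d / 2 + d / 2) by field.
    apply H; replace d with (d / 2 + d / 2) by field;
      apply ball_triangle with (1 := Hb); eapply ball_state_le;
      try eassumption; apply Rmin_l.
Qed.

Lemma tube_lipschitz G :
  (forall t, 0 <= t <= T -> loc_lip G (z t)) ->
  exists M d, 0 < d /\ 0 <= M /\ forall t, 0 <= t <= T ->
    forall s s', ball (z t) d s -> ball (z t) d s' ->
    Rabs (G s - G s') <= M * sdist s s'.
Proof using HT z_cont.
intro HG.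
destruct (tube_uniform (fun M s s' => 0 <= M /\ Rabs (G s - G s') <= M * sdist s s'))
  as [M [d [Hd H]]].
- intros M M' s s' HM [HM0 H]. split; [lra |].
  assert (Hp := sdist_nonneg s s'). nra.
- intros t Ht. destruct (HG t Ht) as [M [d [Hd [HM H]]]].
  exists M, d. split; [exact Hd |]. intros s s' Hs Hs'. split; auto.
- exists M, d. split; [exact Hd |].
  assert (Hc := ball_state_center (z 0) d Hd).
  split; [apply (H 0 ltac:(lra) _ _ Hc Hc) |].
  intros t Ht s s' Hs Hs'. apply (H t Ht s s' Hs Hs').
Qed.

Lemma tube_nonzero G :
  (forall t, 0 <= t <= T -> loc_lip G (z t)) ->
  (forall t, 0 <= t <= T -> G (z t) <> 0) ->
  exists d, 0 < d /\ forall t, 0 <= t <= T ->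
    forall s, ball (z t) d s -> G s <> 0.
Proof using HT z_cont.
intros HG H0.
destruct (tube_uniform (fun _ s _ => G s <> 0)) as [_ [d [Hd H]]].
- auto.
- intros t Ht. assert (Hq := Rabs_pos_lt _ (H0 t Ht)).
  destruct (loc_lip_close _ _ (Rabs (G (z t)) / 2) (HG t Ht) ltac:(lra))
    as [d [Hd H]].
  exists 0, d. split; [exact Hd |]. intros s _ Hs _ Hz.
  specialize (H s Hs). rewrite Hz in H.
  unfold Rminus in H. rewrite Rplus_0_l, Rabs_Ropp in H. lra.
- exists d. split; [exact Hd |]. intros t Ht s Hs. apply (H t Ht s s Hs Hs).
Qed.

Definition tube_bounded (G : R -> state -> R) : Prop :=
  exists M d, 0 < d /\ 0 <= M /\ forall h t s,
    0 < h <= 1 -> 0 <= t <= T -> ball (z t) d s -> Rabs (G h s) <= M.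

Lemma tube_bounded_cont (G : state -> R) :
  (forall t, 0 <= t <= T -> continuous G (z t)) -> tube_bounded (fun _ => G).
Proof using HT z_cont.
intro HG.
destruct (tube_uniform (fun M s _ => Rabs (G s) <= M)) as [M [d [Hd H]]].
- intros. lra.
- intros t Ht.
  destruct (HG t Ht (ball (G (z t)) 1)) as [d Hd];
    [apply (locally_ball (G (z t)) (mkposreal 1 Rlt_0_1)) |].
  exists (Rabs (G (z t)) + 1), d. split; [apply cond_pos |].
  intros s _ Hs _. specialize (Hd s Hs).
  change (Rabs (G s - G (z t)) < 1) in Hd.
  assert (h := Rabs_triang_inv (G s) (G (z t))). lra.
- exists (Rmax M 0), d. split; [exact Hd |]. split; [apply Rmax_r |].
  intros h t s _ Ht Hs. apply Rle_trans with M; [| apply Rmax_l].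
  exact (H t Ht s s Hs Hs).
Qed.

Lemma tube_bounded_lip (G : state -> R) :
  (forall t, 0 <= t <= T -> loc_lip G (z t)) -> tube_bounded (fun _ => G).
Proof using HT z_cont.
intro H. apply tube_bounded_cont. intros t Ht. apply loc_lip_continuous, H, Ht.
Qed.

Lemma tube_bounded_const c : tube_bounded (fun _ _ => c).
Proof using HT z_cont.
apply (tube_bounded_lip (fun _ => c)). intros. apply loc_lip_const.
Qed.

Lemma tube_bounded_step : tube_bounded (fun h _ => h).
Proof using.
exists 1, 1. split; [lra |]. split; [lra |]. intros h t s Hh _ _.
rewrite Rabs_pos_eq; lra.
Qed.

Lemma tube_bounded_ext G K :
  (forall h s, 0 < h <= 1 -> G h s = K h s) -> tube_bounded G -> tube_bounded K.
Proof using HT.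
intros He [M [d [Hd [HM H]]]].
exists M, d. split; [exact Hd |]. split; [exact HM |].
intros h t s Hh Ht Hs. rewrite <- (He h s Hh). apply (H h t); assumption.
Qed.

Lemma tube_bounded_plus G K : tube_bounded G -> tube_bounded K ->
  tube_bounded (fun h s => G h s + K h s).
Proof using.
intros [M [d [Hd [HM H]]]] [M' [d' [Hd' [HM' H']]]].
exists (M + M'), (Rmin d d'). split; [apply Rmin_pos; assumption |].
split; [lra |]. intros h t s Hh Ht Hs.
assert (h1 := H h t s Hh Ht (ball_state_le _ _ _ _ (Rmin_l _ _) Hs)).
assert (h2 := H' h t s Hh Ht (ball_state_le _ _ _ _ (Rmin_r _ _) Hs)).
assert (h3 := Rabs_triang (G h s) (K h s)). lra.
Qed.

Lemma tube_bounded_mult G K : tube_bounded G -> tube_bounded K ->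
  tube_bounded (fun h s => G h s * K h s).
Proof using.
intros [M [d [Hd [HM H]]]] [M' [d' [Hd' [HM' H']]]].
exists (M * M'), (Rmin d d'). split; [apply Rmin_pos; assumption |].
split; [nra |]. intros h t s Hh Ht Hs. rewrite Rabs_mult.
apply Rmult_le_compat; try apply Rabs_pos.
- apply (H h t s Hh Ht (ball_state_le _ _ _ _ (Rmin_l _ _) Hs)).
- apply (H' h t s Hh Ht (ball_state_le _ _ _ _ (Rmin_r _ _) Hs)).
Qed.

Lemma tube_bounded_opp G : tube_bounded G -> tube_bounded (fun h s => - G h s).
Proof using.
intros [M [d [Hd [HM H]]]].
exists M, d. split; [exact Hd |]. split; [exact HM |].
intros h t s Hh Ht Hs. rewrite Rabs_Ropp. apply (H h t); assumption.
Qed.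

Lemma tube_bounded_pow G n : tube_bounded G -> tube_bounded (fun h s => G h s ^ n).
Proof using HT z_cont.
intro H. induction n as [| n IH]; simpl.
- apply tube_bounded_const.
- apply tube_bounded_mult; assumption.
Qed.

End Tube.

(** * Modified equations with a magnetic force at order [h] *)

Section Truncation.

Variable f : nat -> state -> R * R.

Lemma truncation_0 h s : truncation f 0 h s = f O s.
Proof.
unfold truncation. rewrite sum_O. simpl.
apply (scal_one (f O s)).
Qed.

Lemma truncation_succ K h s :
  truncation f (S K) h s
  = (fst (truncation f K h s) + h ^ S K * fst (f (S K) s),
     snd (truncation f K h s) + h ^ S K * snd (f (S K) s)).
Proof. unfold truncation. rewrite sum_Sn. reflexivity. Qed.

End Truncation.

(** The error analysis needs the force explicitly up to order [h]; continuity
    serves to bound the terms of order [h^2] and higher near the orbit. *)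
Definition magnetic_order_one (c : R) (f : nat -> state -> R * R) : Prop :=
  (forall j s, fst s <> (0, 0) ->
     continuous (fun s => fst (f j s)) s /\ continuous (fun s => snd (f j s)) s) /\
  (forall s, fst s <> (0, 0) -> f O s = (grav1 s, grav2 s)) /\
  (forall s, fst s <> (0, 0) -> f 1%nat s = (c * mag1 s, c * mag2 s)).

Section Errors.

Variables (z : R -> state) (T c : R) (f : nat -> state -> R * R) (K : nat).
Hypothesis HT : 0 <= T.
Hypothesis z_moves : forall t, moves z t (grav1 (z t)) (grav2 (z t)).
Hypothesis z_nonzero : forall t, fst (z t) <> (0, 0).
Hypothesis z_angmom : angmom (z 0) <> 0.
Hypothesis z_closed : z T = z 0.
Hypothesis Hf : magnetic_order_one c f.
Hypothesis HK : (1 <= K)%nat.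

(** ** Conservation laws of the exact orbit *)

Lemma orbit_continuous t d : 0 <= t <= T -> 0 < d ->
  exists e, 0 < e /\ forall t', Rabs (t' - t) < e -> ball (z t) d (z t').
Proof using z_moves.
intros _ Hd.
destruct (z_moves t) as [D1 [D2 [D3 D4]]].
assert (Hc : forall u l, is_derive u t l -> exists e, 0 < e /\
  forall t', Rabs (t' - t) < e -> Rabs (u t' - u t) < d).
{ intros u l Du.
  destruct (derivable_continuous_at _ _ _ Du d Hd) as [e [He H]].
  exists e. split; [exact He |]. intros t' Ht'.
  destruct (Req_dec t' t) as [-> | Hne].
  - unfold Rminus. rewrite Rplus_opp_r, Rabs_R0. exact Hd.
  - apply (H t'). split; [split; [exact I | auto] | exact Ht']. }
destruct (Hc _ _ D1) as [e1 [He1 h1]]. destruct (Hc _ _ D2) as [e2 [He2 h2]].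
destruct (Hc _ _ D3) as [e3 [He3 h3]]. destruct (Hc _ _ D4) as [e4 [He4 h4]].
exists (Rmin (Rmin e1 e2) (Rmin e3 e4)).
split; [repeat apply Rmin_pos; assumption |].
intros t' Ht'.
assert (k1 := Rmin_l (Rmin e1 e2) (Rmin e3 e4)).
assert (k2 := Rmin_r (Rmin e1 e2) (Rmin e3 e4)).
assert (k3 := Rmin_l e1 e2). assert (k4 := Rmin_r e1 e2).
assert (k5 := Rmin_l e3 e4). assert (k6 := Rmin_r e3 e4).
apply ball_state. repeat split; [apply h1 | apply h2 | apply h3 | apply h4]; lra.
Qed.

Lemma zero_rate_constant (u : R -> R) :
  (forall t, is_derive u t 0) -> forall t, u t = u 0.
Proof using.
intros Hu t.
destruct (MVT_gen u 0 t (fun _ => 0)) as [xi [_ H]].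
- intros. apply Hu.
- intros r _. apply (derivable_continuous_at _ _ 0), Hu.
- lra.
Qed.

Let z_forced t : moves z t (grav1 (z t) + 0) (grav2 (z t) + 0).
Proof. rewrite !Rplus_0_r. apply z_moves. Qed.

Lemma angmom_constant t : angmom (z t) = angmom (z 0).
Proof using z_moves z_nonzero.
apply (zero_rate_constant (fun t => angmom (z t))). intro r.
eapply is_derive_value;
  [exact (angmom_forced_rate _ _ _ _ (z_forced r) (z_nonzero r)) | ring].
Qed.

Lemma ecc1_constant t : ecc1 (z t) = ecc1 (z 0).
Proof using z_moves z_nonzero.
apply (zero_rate_constant (fun t => ecc1 (z t))). intro r.
eapply is_derive_value;
  [exact (ecc1_forced_rate _ _ _ _ (z_forced r) (z_nonzero r)) | ring].
Qed.

Lemma ecc2_constant t : ecc2 (z t) = ecc2 (z 0).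
Proof using z_moves z_nonzero.
apply (zero_rate_constant (fun t => ecc2 (z t))). intro r.
eapply is_derive_value;
  [exact (ecc2_forced_rate _ _ _ _ (z_forced r) (z_nonzero r)) | ring].
Qed.

(** ** Bounds on the perturbing force *)

Let z_cont := orbit_continuous.
Notation bounded := (tube_bounded z T).

(** Dividing by [h^2] makes this part of the force bounded uniformly in [h]. *)
Definition tail1 (h : R) (s : state) : R :=
  (fst (truncation f K h s) - fst (f O s) - h * fst (f 1%nat s)) / h ^ 2.
Definition tail2 (h : R) (s : state) : R :=
  (snd (truncation f K h s) - snd (f O s) - h * snd (f 1%nat s)) / h ^ 2.

Lemma tail_bounded : bounded tail1 /\ bounded tail2.
Proof using HT z_moves z_nonzero Hf HK.
destruct Hf as [Hcont _].
assert (B1 : forall j, bounded (fun _ s => fst (f j s))).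
{ intro j. apply (tube_bounded_cont _ _ HT z_cont (fun s => fst (f j s))).
  intros t _. apply Hcont, z_nonzero. }
assert (B2 : forall j, bounded (fun _ s => snd (f j s))).
{ intro j. apply (tube_bounded_cont _ _ HT z_cont (fun s => snd (f j s))).
  intros t _. apply Hcont, z_nonzero. }
unfold tail1, tail2. clear Hcont. induction HK as [| n Hn IH].
- split; apply (tube_bounded_ext _ _ HT (fun _ _ => 0));
    try apply (tube_bounded_const _ _ HT z_cont);
    intros h s Hh; rewrite truncation_succ, truncation_0; simpl; field; lra.
- destruct (IH Hn) as [IH1 IH2].
  split; [apply (tube_bounded_ext _ _ HT (fun h s =>
     (fst (truncation f n h s) - fst (f O s) - h * fst (f 1%nat s)) / h ^ 2
     + h ^ (n - 1) * fst (f (S n) s)))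
   | apply (tube_bounded_ext _ _ HT (fun h s =>
     (snd (truncation f n h s) - snd (f O s) - h * snd (f 1%nat s)) / h ^ 2
     + h ^ (n - 1) * snd (f (S n) s)))].
  1,3: intros h s Hh; rewrite truncation_succ; cbn [fst snd];
    replace (h ^ S n) with (h ^ 2 * h ^ (n - 1))
      by (rewrite <- pow_add; f_equal; lia); field; lra.
  all: assert (Bh := tube_bounded_pow _ _ HT z_cont (fun h _ => h) (n - 1)
         (tube_bounded_step z T)).
  all: apply tube_bounded_plus; [assumption |].
  + exact (tube_bounded_mult _ _ _ _ Bh (B1 (S n))).
  + exact (tube_bounded_mult _ _ _ _ Bh (B2 (S n))).
Qed.

Definition force1 (h : R) (s : state) : R := c * mag1 s + h * tail1 h s.
Definition force2 (h : R) (s : state) : R := c * mag2 s + h * tail2 h s.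

Lemma truncation_force h s : 0 < h -> fst s <> (0, 0) ->
  fst (truncation f K h s) = grav1 s + h * force1 h s /\
  snd (truncation f K h s) = grav2 s + h * force2 h s.
Proof using Hf.
intros Hh H0. destruct Hf as [_ [F0 F1]].
unfold force1, force2, tail1, tail2.
rewrite (F0 s H0), (F1 s H0). cbn [fst snd].
split; lazymatch goal with |- ?a = ?b => change (@eq R a b) end; field; lra.
Qed.

Lemma orbit_lip t :
  loc_lip angmom (z t) /\ loc_lip u1 (z t) /\ loc_lip u2 (z t) /\
  loc_lip ecc1 (z t) /\ loc_lip ecc2 (z t) /\ loc_lip cross (z t).
Proof using z_nonzero.
assert (H := z_nonzero t).
split; [apply loc_lip_angmom |]. split; [apply loc_lip_u1, H |].
split; [apply loc_lip_u2, H |]. split; [apply loc_lip_ecc1, H |].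
split; [apply loc_lip_ecc2, H | apply loc_lip_cross, H].
Qed.

Ltac orbit_lips :=
  lazymatch goal with |- loc_lip _ (z ?t) =>
    destruct (orbit_lip t) as [? [? [? [? [? ?]]]]];
    assert (angmom (z t) <> 0) by (rewrite angmom_constant; exact z_angmom);
    loc_lips;
    try first [ assumption
      | apply Rmult_integral_contrapositive_currified;
          [lra | apply pow_nonzero; assumption] ]
  end.

Lemma Q1_lip t : loc_lip Q1 (z t).
Proof using z_moves z_nonzero z_angmom. unfold Q1. orbit_lips; lra. Qed.
Lemma Q2_lip t : loc_lip Q2 (z t).
Proof using z_moves z_nonzero z_angmom. unfold Q2. orbit_lips; lra. Qed.

Ltac bounds :=
  lazymatch goal with
  | |- bounded (fun _ _ => ?c) => apply (tube_bounded_const _ _ HT z_cont)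
  | |- bounded (fun h _ => h) => apply tube_bounded_step
  | |- bounded (fun _ s => @?g s) =>
      apply (tube_bounded_lip _ _ HT z_cont g); intros t _;
      assert (hq1 := Q1_lip t); assert (hq2 := Q2_lip t); orbit_lips; try lra
  | |- bounded (fun h s => @?g h s + @?k h s) =>
      apply (tube_bounded_plus _ _ g k); bounds
  | |- bounded (fun h s => @?g h s - @?k h s) =>
      apply (tube_bounded_plus _ _ g (fun h s => - k h s)); bounds
  | |- bounded (fun h s => @?g h s * @?k h s) =>
      apply (tube_bounded_mult _ _ g k); bounds
  | |- bounded (fun h s => - @?g h s) =>
      apply (tube_bounded_opp _ _ g); bounds
  | |- _ => assumption
  end.

Lemma force_bounded : bounded force1 /\ bounded force2.
Proof using HT z_moves z_nonzero z_angmom Hf HK.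
destruct tail_bounded as [B1 B2].
unfold force1, force2, mag1, mag2. split; bounds.
Qed.

(** Times [h^2], these are the rates of [ecc1 - h c Q1] and [ecc2 - h c Q2]
    along the perturbed solution. *)
Definition rest1 (h : R) (s : state) : R :=
  drift1 s (tail1 h s) (tail2 h s) - c * slip1 s (force1 h s) (force2 h s).
Definition rest2 (h : R) (s : state) : R :=
  drift2 s (tail1 h s) (tail2 h s) - c * slip2 s (force1 h s) (force2 h s).

Lemma rest_bounded : bounded rest1 /\ bounded rest2.
Proof using HT z_moves z_nonzero z_angmom Hf HK.
destruct tail_bounded as [B1 B2]. destruct force_bounded as [B3 B4].
unfold rest1, rest2, slip1, slip2, drift1, drift2. split; bounds.
Qed.

(** ** The change over one period *)

Definition follows (h : R) (s : R -> state) : Prop :=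
  s 0 = z 0 /\
  forall t, 0 <= t <= T -> fst (s t) <> (0, 0) /\
    moves s t (fst (truncation f K h (s t))) (snd (truncation f K h (s t))).

Lemma abs_le_of_sq a b : 0 <= b -> a ^ 2 <= b ^ 2 -> Rabs a <= b.
Proof using.
intros Hb H. rewrite <- (Rabs_pos_eq b Hb). apply Rsqr_le_abs_0.
unfold Rsqr. lra.
Qed.

Lemma sdist_le_of_sq s s' b : 0 <= b ->
  (X1 s - X1 s') ^ 2 + (X2 s - X2 s') ^ 2
  + (V1 s - V1 s') ^ 2 + (V2 s - V2 s') ^ 2 <= b ^ 2 ->
  sdist s s' <= 4 * b /\ forall d, b < d -> ball s' d s.
Proof using.
intros Hb H.
assert (p1 := pow2_ge_0 (X1 s - X1 s')). assert (p2 := pow2_ge_0 (X2 s - X2 s')).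
assert (p3 := pow2_ge_0 (V1 s - V1 s')). assert (p4 := pow2_ge_0 (V2 s - V2 s')).
assert (H1 : Rabs (X1 s - X1 s') <= b) by (apply abs_le_of_sq; lra).
assert (H2 : Rabs (X2 s - X2 s') <= b) by (apply abs_le_of_sq; lra).
assert (H3 : Rabs (V1 s - V1 s') <= b) by (apply abs_le_of_sq; lra).
assert (H4 : Rabs (V2 s - V2 s') <= b) by (apply abs_le_of_sq; lra).
split; [unfold sdist; lra |]. intros d Hd. apply ball_state. lra.
Qed.

(** Gravity is Lipschitz and the perturbing force [O(h)] as long as the solution
    stays in a tube around the orbit; the bound that Gronwall's inequality
    yields there keeps it in the tube when [h] is small. *)
Lemma orbit_shadowed d : 0 < d ->
  exists N h0, 0 <= N /\ 0 < h0 <= 1 /\ forall h s, 0 < h < h0 -> follows h s ->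
    forall t, 0 <= t <= T -> ball (z t) d (s t) /\ sdist (s t) (z t) <= N * h.
Proof using HT z_moves z_nonzero z_angmom Hf HK.
intro Hd0.
destruct (tube_lipschitz _ _ HT z_cont grav1) as [L1 [d1 [Hd1 [HL1 G1]]]];
  [intros; apply loc_lip_grav1, z_nonzero |].
destruct (tube_lipschitz _ _ HT z_cont grav2) as [L2 [d2 [Hd2 [HL2 G2]]]];
  [intros; apply loc_lip_grav2, z_nonzero |].
destruct force_bounded as [[B1 [d3 [Hd3 [HB1 F1]]]] [B2 [d4 [Hd4 [HB2 F2]]]]].
set (e := Rmin d (Rmin (Rmin d1 d2) (Rmin d3 d4))).
assert (He : 0 < e /\ e <= d /\ e <= d1 /\ e <= d2 /\ e <= d3 /\ e <= d4).
{ split; [unfold e; repeat apply Rmin_pos; assumption |].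
  assert (k0 := Rmin_l d (Rmin (Rmin d1 d2) (Rmin d3 d4))).
  assert (k1 := Rmin_r d (Rmin (Rmin d1 d2) (Rmin d3 d4))).
  assert (k2 := Rmin_l (Rmin d1 d2) (Rmin d3 d4)).
  assert (k3 := Rmin_r (Rmin d1 d2) (Rmin d3 d4)).
  assert (k4 := Rmin_l d1 d2). assert (k5 := Rmin_r d1 d2).
  assert (k6 := Rmin_l d3 d4). assert (k7 := Rmin_r d3 d4).
  unfold e. lra. }
destruct He as [He [Hed [He1 [He2 [He3 He4]]]]]. clearbody e.
(* from [2 p q <= p^2 + q^2] and [sdist^2 <= 4 E] below *)
set (k := 3 + 4 * L1 ^ 2 + 4 * L2 ^ 2).
assert (Hk : 0 <= k) by (unfold k; nra).
set (N0 := (B1 ^ 2 + B2 ^ 2) * T * exp (k * T)).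
assert (HN0 : 0 <= N0).
{ unfold N0. assert (h1 := exp_pos (k * T)).
  assert (0 <= (B1 ^ 2 + B2 ^ 2) * T) by nra. nra. }
set (N1 := N0 + 1).
exists (4 * N1), (Rmin 1 (e / N1)).
assert (HN1 : 1 <= N1) by (unfold N1; lra).
split; [lra |].
assert (Hq : 0 < e / N1) by (apply Rdiv_lt_0_compat; lra).
split; [split; [apply Rmin_pos; lra | apply Rmin_l] |].
intros h s [Hh0 Hh] [Hinit Hs].
assert (Hh1 : h < 1) by (assert (h1 := Rmin_l 1 (e / N1)); lra).
assert (HhN : h * N1 < e).
{ assert (h1 := Rmin_r 1 (e / N1)).
  apply Rlt_le_trans with (e / N1 * N1); [apply Rmult_lt_compat_r; lra |].
  right. field. lra. }
assert (HhN0 : 0 <= h * N1) by nra.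
set (E := fun t => (X1 (s t) - X1 (z t)) ^ 2 + (X2 (s t) - X2 (z t)) ^ 2
  + (V1 (s t) - V1 (z t)) ^ 2 + (V2 (s t) - V2 (z t)) ^ 2).
set (dE := fun t => 2 * (
  (X1 (s t) - X1 (z t)) * (V1 (s t) - V1 (z t))
  + (X2 (s t) - X2 (z t)) * (V2 (s t) - V2 (z t))
  + (V1 (s t) - V1 (z t)) * (grav1 (s t) - grav1 (z t) + h * force1 h (s t))
  + (V2 (s t) - V2 (z t)) * (grav2 (s t) - grav2 (z t) + h * force2 h (s t)))).
set (m := h ^ 2 * (B1 ^ 2 + B2 ^ 2)).
assert (HN0' : m * T * exp (k * T) = h ^ 2 * N0) by (unfold m, N0; ring).
assert (HNN : N0 <= N1 ^ 2) by (unfold N1; nra).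
assert (HE : forall t, 0 <= t <= T -> E t <= (h * N1) ^ 2).
{ intros t Ht.
  apply Rle_trans with (m * T * exp (k * T)).
  2: { rewrite HN0', Rpow_mult_distr. apply Rmult_le_compat_l; [nra | exact HNN]. }
  apply gronwall_confined with (dE := dE) (d := e ^ 2); try assumption.
  - unfold m. assert (0 <= B1 ^ 2 + B2 ^ 2) by nra. nra.
  - intros r Hr. destruct (Hs r Hr) as [H0 Hm].
    destruct (truncation_force h (s r) Hh0 H0) as [Hf1 Hf2].
    rewrite Hf1, Hf2 in Hm.
    destruct Hm as [Da [Db [Dc Dd]]].
    destruct (z_moves r) as [Dx [Dy [Dv Dw]]].
    eapply is_derive_value; [unfold E; rates |].
    unfold dE. simpl INR. simpl Init.Nat.pred. ring.
  - unfold E. rewrite Hinit. ring.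
  - intros r Hr HEr.
    assert (Hball : ball (z r) e (s r)).
    { assert (Habs : forall a, a ^ 2 < e ^ 2 -> Rabs a < e).
      { intros a Ha. rewrite <- (Rabs_pos_eq e) by lra.
        apply Rsqr_lt_abs_0. unfold Rsqr. lra. }
      unfold E in HEr. apply ball_state.
      assert (p1 := pow2_ge_0 (X1 (s r) - X1 (z r))).
      assert (p2 := pow2_ge_0 (X2 (s r) - X2 (z r))).
      assert (p3 := pow2_ge_0 (V1 (s r) - V1 (z r))).
      assert (p4 := pow2_ge_0 (V2 (s r) - V2 (z r))).
      split; [| split; [| split]]; apply Habs; lra. }
    assert (Hc := ball_state_center (z r)).
    assert (g1 := G1 r Hr _ _ (ball_state_le _ _ _ _ He1 Hball) (Hc _ Hd1)).
    assert (g2 := G2 r Hr _ _ (ball_state_le _ _ _ _ He2 Hball) (Hc _ Hd2)).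
    assert (f1 := F1 h r (s r) ltac:(lra) Hr (ball_state_le _ _ _ _ He3 Hball)).
    assert (f2 := F2 h r (s r) ltac:(lra) Hr (ball_state_le _ _ _ _ He4 Hball)).
    assert (Hsd : sdist (s r) (z r) ^ 2 <= 4 * E r).
    { unfold sdist, E.
      rewrite <- (pow2_abs (X1 (s r) - X1 (z r))), <- (pow2_abs (X2 (s r) - X2 (z r))),
        <- (pow2_abs (V1 (s r) - V1 (z r))), <- (pow2_abs (V2 (s r) - V2 (z r))).
      generalize (Rabs (X1 (s r) - X1 (z r))) (Rabs (X2 (s r) - X2 (z r)))
        (Rabs (V1 (s r) - V1 (z r))) (Rabs (V2 (s r) - V2 (z r))).
      intros a b p q.
      assert (w1 := pow2_ge_0 (a - b)). assert (w2 := pow2_ge_0 (a - p)).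
      assert (w3 := pow2_ge_0 (a - q)). assert (w4 := pow2_ge_0 (b - p)).
      assert (w5 := pow2_ge_0 (b - q)). assert (w6 := pow2_ge_0 (p - q)).
      lra. }
    assert (sq : forall a b, Rabs a <= b -> a ^ 2 <= b ^ 2).
    { intros a b Hab. rewrite <- pow2_abs. apply pow_incr.
      split; [apply Rabs_pos | exact Hab]. }
    apply sq in g1. apply sq in g2. apply sq in f1. apply sq in f2.
    rewrite Rpow_mult_distr in g1, g2.
    assert (g1' : (grav1 (s r) - grav1 (z r)) ^ 2 <= 4 * L1 ^ 2 * E r).
    { apply Rle_trans with (1 := g1). assert (q := pow2_ge_0 L1). nra. }
    assert (g2' : (grav2 (s r) - grav2 (z r)) ^ 2 <= 4 * L2 ^ 2 * E r).
    { apply Rle_trans with (1 := g2). assert (q := pow2_ge_0 L2). nra. }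
    assert (f1' : (h * force1 h (s r)) ^ 2 <= h ^ 2 * B1 ^ 2).
    { rewrite Rpow_mult_distr. apply Rmult_le_compat_l; [apply pow2_ge_0 | exact f1]. }
    assert (f2' : (h * force2 h (s r)) ^ 2 <= h ^ 2 * B2 ^ 2).
    { rewrite Rpow_mult_distr. apply Rmult_le_compat_l; [apply pow2_ge_0 | exact f2]. }
    unfold k, m. 
    assert (Hfin : dE r <= 3 * E r + (grav1 (s r) - grav1 (z r)) ^ 2
      + (grav2 (s r) - grav2 (z r)) ^ 2 + (h * force1 h (s r)) ^ 2
      + (h * force2 h (s r)) ^ 2).
    { unfold dE, E.
      generalize (X1 (s r) - X1 (z r)) (X2 (s r) - X2 (z r)) (V1 (s r) - V1 (z r))
        (V2 (s r) - V2 (z r)) (grav1 (s r) - grav1 (z r))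
        (grav2 (s r) - grav2 (z r)) (h * force1 h (s r)) (h * force2 h (s r)).
      intros a b p q u v w x.
      assert (w1 := pow2_ge_0 (a - p)). assert (w2 := pow2_ge_0 (b - q)).
      assert (w3 := pow2_ge_0 (p - u)). assert (w4 := pow2_ge_0 (p - w)).
      assert (w5 := pow2_ge_0 (q - v)). assert (w6 := pow2_ge_0 (q - x)).
      assert (w7 := pow2_ge_0 a). assert (w8 := pow2_ge_0 b).
      lra. }
    lra.
  - rewrite HN0'. apply Rle_lt_trans with ((h * N1) ^ 2).
    + rewrite Rpow_mult_distr. apply Rmult_le_compat_l; [nra | exact HNN].
    + nra. }
intros t Ht.
destruct (sdist_le_of_sq (s t) (z t) (h * N1) HhN0 (HE t Ht)) as [Hdist Hb].
split; [apply Hb; lra | lra].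
Qed.

(** After one period the perturbed solution, and with it the single-valued
    function [Q], has returned to its initial value up to [O(h)]. As
    [e - h c Q] changes by [O(h^2)], so does [e]. *)
Lemma drift_over_period (e Q : state -> R) (rest : R -> state -> R) :
  (forall t, loc_lip e (z t)) -> (forall t, loc_lip Q (z t)) ->
  (forall t, e (z t) = e (z 0)) -> bounded rest ->
  (forall h s t, 0 < h -> fst (s t) <> (0, 0) -> angmom (s t) <> 0 ->
     moves s t (fst (truncation f K h (s t))) (snd (truncation f K h (s t))) ->
     is_derive (fun t => e (s t) - h * c * Q (s t)) t (h ^ 2 * rest h (s t))) ->
  exists C h0, 0 <= C /\ 0 < h0 /\ forall h s, 0 < h < h0 -> follows h s ->
    (forall t, 0 <= t <= T -> Rabs (e (s t) - e (z 0)) <= C * h) /\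
    Rabs (e (s T) - e (z 0)) <= C * h ^ 2.
Proof using HT z_moves z_nonzero z_angmom z_closed Hf HK.
intros He HQ Hconst [B [d1 [Hd1 [HB HR]]]] Hrate.
destruct (tube_lipschitz _ _ HT z_cont e) as [L1 [d2 [Hd2 [HL1 Ge]]]];
  [intros; apply He |].
destruct (tube_lipschitz _ _ HT z_cont Q) as [L2 [d3 [Hd3 [HL2 GQ]]]];
  [intros; apply HQ |].
destruct (tube_nonzero _ _ HT z_cont angmom) as [d4 [Hd4 HL]].
{ intros t _. apply loc_lip_angmom. }
{ intros t _. rewrite angmom_constant. exact z_angmom. }
destruct (orbit_shadowed (Rmin (Rmin d1 d2) (Rmin d3 d4)))
  as [N [h0 [HN [Hh0 Hshadow]]]]; [repeat apply Rmin_pos; assumption |].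
assert (k1 := Rmin_l (Rmin d1 d2) (Rmin d3 d4)).
assert (k2 := Rmin_r (Rmin d1 d2) (Rmin d3 d4)).
assert (k3 := Rmin_l d1 d2). assert (k4 := Rmin_r d1 d2).
assert (k5 := Rmin_l d3 d4). assert (k6 := Rmin_r d3 d4).
assert (Hcabs := Rabs_pos c).
exists (L1 * N + (B * T + Rabs c * (L2 * N))), h0.
assert (P1 : 0 <= L1 * N) by nra. assert (P2 : 0 <= B * T) by nra.
assert (P3 : 0 <= Rabs c * (L2 * N)) by (apply Rmult_le_pos; nra).
split; [lra |]. split; [lra |].
intros h s Hh Hs.
assert (Hb : forall t, 0 <= t <= T -> forall d, Rmin (Rmin d1 d2) (Rmin d3 d4) <= d ->
  ball (z t) d (s t)).
{ intros t Ht d Hd. eapply ball_state_le; [exact Hd |].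
  apply (Hshadow h s Hh Hs t Ht). }
assert (Hnear : forall t, 0 <= t <= T -> sdist (s t) (z t) <= N * h)
  by (intros t Ht; apply (Hshadow h s Hh Hs t Ht)).
split.
- intros t Ht. rewrite <- (Hconst t).
  apply Rle_trans with (L1 * sdist (s t) (z t)).
  + apply (Ge t Ht); [apply Hb; [exact Ht | lra] | apply ball_state_center, Hd2].
  + specialize (Hnear t Ht). nra.
- destruct Hs as [Hinit Hs].
  assert (Hu := mean_value_bound (fun t => e (s t) - h * c * Q (s t))
    (fun t => h ^ 2 * rest h (s t)) T (h ^ 2 * B) HT). cbv beta in Hu.
  assert (Hu' : Rabs (e (s T) - h * c * Q (s T) - (e (s 0) - h * c * Q (s 0)))
    <= h ^ 2 * B * T).
  { apply Hu.
    - intros t Ht. destruct (Hs t Ht) as [H0 Hm].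
      apply Hrate; try assumption; [lra |].
      apply (HL t Ht), Hb; [exact Ht | lra].
    - intros t Ht. rewrite Rabs_mult, (Rabs_pos_eq (h ^ 2)) by apply pow2_ge_0.
      apply Rmult_le_compat_l; [apply pow2_ge_0 |].
      apply (HR h t); [lra | exact Ht |]. apply Hb; [exact Ht | lra]. }
  clear Hu. rewrite Hinit in Hu'.
  assert (HT' : 0 <= T <= T) by lra.
  assert (HQT : Rabs (Q (s T) - Q (z 0)) <= L2 * (N * h)).
  { rewrite <- z_closed. apply Rle_trans with (L2 * sdist (s T) (z T)).
    - apply (GQ T HT'); [apply Hb; [exact HT' | lra] | apply ball_state_center, Hd3].
    - apply Rmult_le_compat_l; [exact HL2 | apply Hnear, HT']. }
  replace (e (s T) - e (z 0)) with
    ((e (s T) - h * c * Q (s T) - (e (z 0) - h * c * Q (z 0)))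
     + h * (c * (Q (s T) - Q (z 0)))) by ring.
  apply Rle_trans with (1 := Rabs_triang _ _).
  rewrite !Rabs_mult, (Rabs_pos_eq h) by lra.
  assert (Hcq : Rabs c * Rabs (Q (s T) - Q (z 0)) <= Rabs c * (L2 * (N * h)))
    by (apply Rmult_le_compat_l; assumption).
  assert (Hfin : h * (Rabs c * Rabs (Q (s T) - Q (z 0))) <= h * (Rabs c * (L2 * (N * h))))
    by (apply Rmult_le_compat_l; lra).
  assert (Hpos : 0 <= L1 * N * h ^ 2) by (apply Rmult_le_pos; [lra | apply pow2_ge_0]).
  lra.
Qed.

(** At order [h] the drift of [ecc1] is cancelled by the rate of
    [c Q1] along the Kepler flow. *)
Lemma ecc1_Q1_rate h s t : 0 < h -> fst (s t) <> (0, 0) -> angmom (s t) <> 0 ->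
  moves s t (fst (truncation f K h (s t))) (snd (truncation f K h (s t))) ->
  is_derive (fun t => ecc1 (s t) - h * c * Q1 (s t)) t (h ^ 2 * rest1 h (s t)).
Proof using Hf.
intros Hh H0 HL Hm.
destruct (truncation_force h (s t) Hh H0) as [E1 E2]. rewrite E1, E2 in Hm.
assert (D1 := ecc1_forced_rate _ _ _ _ Hm H0).
assert (DQ := Q1_forced_rate _ _ _ _ Hm H0 HL).
eapply is_derive_value; [rates |].
unfold rest1, slip1, drift1, drift2, force1, force2. ring.
Qed.

Lemma ecc2_Q2_rate h s t : 0 < h -> fst (s t) <> (0, 0) -> angmom (s t) <> 0 ->
  moves s t (fst (truncation f K h (s t))) (snd (truncation f K h (s t))) ->
  is_derive (fun t => ecc2 (s t) - h * c * Q2 (s t)) t (h ^ 2 * rest2 h (s t)).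
Proof using Hf.
intros Hh H0 HL Hm.
destruct (truncation_force h (s t) Hh H0) as [E1 E2]. rewrite E1, E2 in Hm.
assert (D1 := ecc2_forced_rate _ _ _ _ Hm H0).
assert (DQ := Q2_forced_rate _ _ _ _ Hm H0 HL).
eapply is_derive_value; [rates |].
unfold rest2, slip2, drift1, drift2, force1, force2. ring.
Qed.

Lemma lrl_drift_over_period :
  exists C h0, 0 <= C /\ 0 < h0 /\ forall h s, 0 < h < h0 -> follows h s ->
    (forall t, 0 <= t <= T -> Rabs (ecc1 (s t) - ecc1 (z 0)) <= C * h /\
                              Rabs (ecc2 (s t) - ecc2 (z 0)) <= C * h) /\
    Rabs (ecc1 (s T) - ecc1 (z 0)) <= C * h ^ 2 /\
    Rabs (ecc2 (s T) - ecc2 (z 0)) <= C * h ^ 2.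
Proof using HT z_moves z_nonzero z_angmom z_closed Hf HK.
destruct rest_bounded as [R1 R2].
destruct (drift_over_period ecc1 Q1 rest1) as [C1 [h1 [HC1 [Hh1 H1]]]];
  [intro; apply orbit_lip | apply Q1_lip | apply ecc1_constant | exact R1
  | apply ecc1_Q1_rate |].
destruct (drift_over_period ecc2 Q2 rest2) as [C2 [h2 [HC2 [Hh2 H2]]]];
  [intro; apply orbit_lip | apply Q2_lip | apply ecc2_constant | exact R2
  | apply ecc2_Q2_rate |].
exists (C1 + C2), (Rmin h1 h2).
split; [lra |]. split; [apply Rmin_pos; assumption |].
intros h s Hh Hs.
assert (k1 := Rmin_l h1 h2). assert (k2 := Rmin_r h1 h2).
destruct (H1 h s ltac:(lra) Hs) as [E1 E1'].
destruct (H2 h s ltac:(lra) Hs) as [E2 E2'].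
assert (Hp : 0 <= h ^ 2) by apply pow2_ge_0.
split; [| split; nra].
intros t Ht. specialize (E1 t Ht). specialize (E2 t Ht). split; nra.
Qed.

End Errors.

(** * The order-one term of the modified equation *)

Lemma continuous_close (G : state -> R) s0 eps : continuous G s0 -> 0 < eps ->
  exists d, 0 < d /\ forall s, ball s0 d s -> Rabs (G s - G s0) <= eps.
Proof.
intros HG He.
destruct (HG (ball (G s0) eps)) as [d Hd];
  [apply (locally_ball (G s0) (mkposreal eps He)) |].
exists d. split; [apply cond_pos |]. intros s Hs. specialize (Hd s Hs).
change (Rabs (G s - G s0) < eps) in Hd. lra.
Qed.

Lemma rate_scaled (u : R -> R) (k t l : R) :
  is_derive u (k * t) l -> is_derive (fun t => u (k * t)) t (k * l).
Proof.
intro H.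
assert (D : is_derive (fun t => k * t) t k).
{ eapply is_derive_value; [rates | ring]. }
exact (is_derive_comp u _ t _ _ H D).
Qed.

(** The second difference is symmetric in time: only the even part of the
    acceleration enters its error. *)
Lemma second_difference_bound (u v a : R -> R) h e : 0 <= h ->
  (forall t, - h <= t <= h -> is_derive u t (v t) /\ is_derive v t (a t)) ->
  (forall t, 0 <= t <= h -> Rabs (a t + a (- t) - 2 * a 0) <= e) ->
  Rabs (u h - 2 * u 0 + u (- h) - h ^ 2 * a 0) <= e * h ^ 2.
Proof.
intros Hh Hd Ha.
assert (He : 0 <= e).
{ apply Rle_trans with (2 := Ha 0 ltac:(lra)). apply Rabs_pos. }
set (chi := fun t => v t - v (-1 * t) - 2 * a 0 * t).
set (psi := fun t => u t + u (-1 * t) - a 0 * t ^ 2).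
assert (Dneg : forall (w : R -> R) (l t : R), 0 <= t <= h ->
  is_derive w (-1 * t) l -> is_derive (fun t : R => w (-1 * t)) t (-1 * l)).
{ intros w l t _. apply rate_scaled. }
assert (Hchi : forall t, 0 <= t <= h -> Rabs (chi t) <= e * h).
{ intros t Ht.
  assert (H := mean_value_bound chi (fun t => a t + a (- t) - 2 * a 0) t e ltac:(lra)).
  assert (H0 : chi 0 = 0) by (unfold chi; rewrite Rmult_0_r; ring).
  rewrite H0, Rminus_0_r in H.
  apply Rle_trans with (e * t); [apply H | nra].
  - intros r Hr. destruct (Hd r ltac:(lra)) as [_ D].
    destruct (Hd (-1 * r) ltac:(lra)) as [_ D'].
    apply Dneg in D'; [| lra].
    eapply is_derive_value; [unfold chi; rates |].
    replace (-1 * r) with (- r) by ring. ring.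
  - intros r Hr. apply Ha. lra. }
assert (H := mean_value_bound psi chi h (e * h) Hh).
replace (u h - 2 * u 0 + u (- h) - h ^ 2 * a 0) with (psi h - psi 0).
- replace (e * h ^ 2) with (e * h * h) by ring. apply H; [| exact Hchi].
  intros r Hr. destruct (Hd r ltac:(lra)) as [D _].
  destruct (Hd (-1 * r) ltac:(lra)) as [D' _].
  apply Dneg in D'; [| lra].
  eapply is_derive_value; [unfold psi; rates |].
  unfold chi. simpl. ring.
- unfold psi. rewrite Rmult_0_r. replace (-1 * h) with (- h) by ring. ring.
Qed.

Lemma linear_expansion_bound (p w : R -> R) a h e : 0 <= h ->
  (forall t, 0 <= t <= h -> is_derive p t (w t)) ->
  (forall t, 0 <= t <= h -> Rabs (w t - a) <= e) ->
  Rabs (p h - p 0 - h * a) <= e * h.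
Proof.
intros Hh Hd Hw.
replace (p h - p 0 - h * a) with ((p h - a * h) - (p 0 - a * 0)) by ring.
apply (mean_value_bound (fun t => p t - a * t) (fun t => w t - a)); try assumption.
intros t Ht. specialize (Hd t Ht).
eapply is_derive_value; [rates | ring].
Qed.

Section ShortTime.

Variables (f : nat -> state -> R * R) (s0 : state).
Hypothesis H0 : fst s0 <> (0, 0).
Hypothesis f_cont : forall j,
  continuous (fun s => fst (f j s)) s0 /\ continuous (fun s => snd (f j s)) s0.
Hypothesis f_zero : forall s, fst s <> (0, 0) -> f O s = (grav1 s, grav2 s).

Definition short_solution (h : R) (s : R -> state) : Prop :=
  s 0 = s0 /\
  forall t, - h <= t <= h -> fst (s t) <> (0, 0) /\
    moves s t (fst (truncation f 1 h (s t))) (snd (truncation f 1 h (s t))).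

Lemma truncation_one h s :
  truncation f 1 h s
  = (fst (f O s) + h * fst (f 1%nat s), snd (f O s) + h * snd (f 1%nat s)).
Proof using. rewrite truncation_succ, truncation_0. f_equal; simpl; ring. Qed.

(** The initial point plays the part of the exact orbit: near it the velocity
    and the force are bounded, so that Gronwall's argument applies. *)
Lemma short_solution_stays d : 0 < d ->
  exists h1, 0 < h1 /\ forall h s, 0 < h < h1 -> short_solution h s ->
    forall t, - h <= t <= h -> ball s0 d (s t).
Proof using f_cont.
intro Hd.
assert (Hbd : forall G, continuous G s0 -> exists B e, 0 < e /\ 0 <= B /\
  forall s, ball s0 e s -> Rabs (G s) <= B).
{ intros G HG. destruct (continuous_close G s0 1 HG Rlt_0_1) as [e [He HB]].
  exists (Rabs (G s0) + 1), e. split; [exact He |].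
  assert (h := Rabs_pos (G s0)). split; [lra |]. intros s Hs.
  specialize (HB s Hs). assert (h' := Rabs_triang_inv (G s) (G s0)). lra. }
destruct (Hbd _ (proj1 (f_cont 0%nat))) as [B1 [e1 [He1 [HB1 b1]]]].
destruct (Hbd _ (proj2 (f_cont 0%nat))) as [B2 [e2 [He2 [HB2 b2]]]].
destruct (Hbd _ (proj1 (f_cont 1%nat))) as [B3 [e3 [He3 [HB3 b3]]]].
destruct (Hbd _ (proj2 (f_cont 1%nat))) as [B4 [e4 [He4 [HB4 b4]]]].
set (e := Rmin d (Rmin (Rmin e1 e2) (Rmin e3 e4))).
assert (He : 0 < e /\ e <= d /\ e <= e1 /\ e <= e2 /\ e <= e3 /\ e <= e4).
{ split; [unfold e; repeat apply Rmin_pos; assumption |].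
  assert (k0 := Rmin_l d (Rmin (Rmin e1 e2) (Rmin e3 e4))).
  assert (k1 := Rmin_r d (Rmin (Rmin e1 e2) (Rmin e3 e4))).
  assert (k2 := Rmin_l (Rmin e1 e2) (Rmin e3 e4)).
  assert (k3 := Rmin_r (Rmin e1 e2) (Rmin e3 e4)).
  assert (k4 := Rmin_l e1 e2). assert (k5 := Rmin_r e1 e2).
  assert (k6 := Rmin_l e3 e4). assert (k7 := Rmin_r e3 e4).
  unfold e. lra. }
destruct He as [He [Hed [l1 [l2 [l3 l4]]]]]. clearbody e.
set (W1 := Rabs (V1 s0) + e). set (W2 := Rabs (V2 s0) + e).
set (m := W1 ^ 2 + W2 ^ 2 + (B1 + B3) ^ 2 + (B2 + B4) ^ 2).
assert (Hm : 0 < m).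
{ assert (q1 := Rabs_pos (V1 s0)).
  assert (q2 := pow2_ge_0 W2). assert (q3 := pow2_ge_0 (B1 + B3)).
  assert (q4 := pow2_ge_0 (B2 + B4)).
  assert (0 < W1 ^ 2) by (apply pow_lt; unfold W1; lra). unfold m. lra. }
assert (Hq : 0 < e ^ 2 / (3 * m)) by (apply Rdiv_lt_0_compat; [apply pow_lt |]; lra).
exists (Rmin 1 (e ^ 2 / (3 * m))).
split; [apply Rmin_pos; lra |].
intros h s [Hh0 Hh] [Hinit Hs].
assert (Hh1 : h < 1) by (assert (q := Rmin_l 1 (e ^ 2 / (3 * m))); lra).
assert (Hhm : m * h * 3 < e ^ 2).
{ assert (q := Rmin_r 1 (e ^ 2 / (3 * m))).
  apply Rlt_le_trans with (m * (e ^ 2 / (3 * m)) * 3).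
  - apply Rmult_lt_compat_r; [lra |]. apply Rmult_lt_compat_l; lra.
  - right. field. lra. }
assert (Hexp : exp (1 * h) <= 3).
{ apply Rle_trans with (exp 1); [left; apply exp_increasing; lra | apply exp_le_3]. }
set (E := fun t => (X1 (s t) - X1 s0) ^ 2 + (X2 (s t) - X2 s0) ^ 2
  + (V1 (s t) - V1 s0) ^ 2 + (V2 (s t) - V2 s0) ^ 2).
set (F1 := fun t => fst (truncation f 1 h (s t))).
set (F2 := fun t => snd (truncation f 1 h (s t))).
set (dE := fun t => 2 * ((X1 (s t) - X1 s0) * V1 (s t)
  + (X2 (s t) - X2 s0) * V2 (s t)
  + (V1 (s t) - V1 s0) * F1 t + (V2 (s t) - V2 s0) * F2 t)).
assert (HdE : forall t, - h <= t <= h -> is_derive E t (dE t)).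
{ intros t Ht. destruct (Hs t Ht) as [_ [D1 [D2 [D3 D4]]]].
  eapply is_derive_value; [unfold E; rates |].
  unfold dE, F1, F2. simpl INR. simpl Init.Nat.pred. ring. }
assert (Hball : forall t, E t < e ^ 2 -> ball s0 e (s t)).
{ intros t Ht. apply ball_state.
  assert (Habs : forall a, a ^ 2 < e ^ 2 -> Rabs a < e).
  { intros a Ha. rewrite <- (Rabs_pos_eq e) by lra.
    apply Rsqr_lt_abs_0. unfold Rsqr. lra. }
  unfold E in Ht.
  assert (p1 := pow2_ge_0 (X1 (s t) - X1 s0)).
  assert (p2 := pow2_ge_0 (X2 (s t) - X2 s0)).
  assert (p3 := pow2_ge_0 (V1 (s t) - V1 s0)).
  assert (p4 := pow2_ge_0 (V2 (s t) - V2 s0)).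
  split; [| split; [| split]]; apply Habs; lra. }
assert (HdE' : forall t, E t < e ^ 2 -> Rabs (dE t) <= E t + m).
{ intros t Ht. assert (Hb := Hball t Ht).
  assert (sq : forall a b, Rabs a <= b -> a ^ 2 <= b ^ 2).
  { intros a b Hab. rewrite <- pow2_abs. apply pow_incr.
    split; [apply Rabs_pos | exact Hab]. }
  assert (c1 := b1 _ (ball_state_le _ _ _ _ l1 Hb)).
  assert (c2 := b2 _ (ball_state_le _ _ _ _ l2 Hb)).
  assert (c3 := b3 _ (ball_state_le _ _ _ _ l3 Hb)).
  assert (c4 := b4 _ (ball_state_le _ _ _ _ l4 Hb)).
  assert (HF : forall a b A B, Rabs a <= A -> Rabs b <= B -> Rabs (a + h * b) <= A + B).
  { intros a b A B Ha Hb'. apply Rle_trans with (1 := Rabs_triang _ _).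
    rewrite Rabs_mult, (Rabs_pos_eq h) by lra. assert (q := Rabs_pos b). nra. }
  assert (q1 : F1 t ^ 2 <= (B1 + B3) ^ 2).
  { apply sq. unfold F1. rewrite truncation_one. apply HF; assumption. }
  assert (q2 : F2 t ^ 2 <= (B2 + B4) ^ 2).
  { apply sq. unfold F2. rewrite truncation_one. apply HF; assumption. }
  apply ball_state in Hb. destruct Hb as [_ [_ [v1 v2]]].
  assert (q3 : V1 (s t) ^ 2 <= W1 ^ 2).
  { apply sq. unfold W1. assert (q := Rabs_triang_inv (V1 (s t)) (V1 s0)). lra. }
  assert (q4 : V2 (s t) ^ 2 <= W2 ^ 2).
  { apply sq. unfold W2. assert (q := Rabs_triang_inv (V2 (s t)) (V2 s0)). lra. }
  unfold m. apply Rle_trans with (E t + V1 (s t) ^ 2 + V2 (s t) ^ 2 + F1 t ^ 2 + F2 t ^ 2);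
    [| lra].
  unfold dE, E.
  generalize (X1 (s t) - X1 s0) (X2 (s t) - X2 s0) (V1 (s t) - V1 s0)
    (V2 (s t) - V2 s0).
  generalize (V1 (s t)) (V2 (s t)) (F1 t) (F2 t).
  intros u v w x a b p q.
  assert (w1 := pow2_ge_0 (a - u)). assert (w2 := pow2_ge_0 (b - v)).
  assert (w3 := pow2_ge_0 (p - w)). assert (w4 := pow2_ge_0 (q - x)).
  assert (w5 := pow2_ge_0 (a + u)). assert (w6 := pow2_ge_0 (b + v)).
  assert (w7 := pow2_ge_0 (p + w)). assert (w8 := pow2_ge_0 (q + x)).
  apply Rabs_le. lra. }
(* forward and backward in time at once, through the factor [k] *)
assert (Hside : forall k, k = 1 \/ k = -1 -> forall t, 0 <= t <= h ->
  E (k * t) <= m * h * exp (1 * h)).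
{ intros k Hk.
  apply (gronwall_confined (fun t => E (k * t)) (fun t => k * dE (k * t)) h (e ^ 2) 1 m);
    try lra.
  - intros t Ht. apply rate_scaled, HdE. destruct Hk as [-> | ->]; lra.
  - rewrite Rmult_0_r. unfold E. rewrite Hinit. ring.
  - intros t Ht HEt. specialize (HdE' _ HEt). apply Rabs_le_between in HdE'.
    destruct Hk as [-> | ->]; lra.
  - apply Rle_lt_trans with (2 := Hhm). apply Rmult_le_compat_l; [nra | exact Hexp]. }
intros t Ht. apply ball_state_le with (1 := Hed). apply Hball.
apply Rle_lt_trans with (m * h * exp (1 * h)).
- destruct (Rle_lt_dec 0 t) as [Hp | Hn].
  + replace t with (1 * t) by ring. apply Hside; lra.
  + replace t with (-1 * (- t)) by ring. apply Hside; lra.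
- apply Rle_lt_trans with (2 := Hhm). apply Rmult_le_compat_l; [nra | exact Hexp].
Qed.

Lemma short_solution_value (G : state -> R) eps : continuous G s0 -> 0 < eps ->
  exists h1, 0 < h1 /\ forall h s, 0 < h < h1 -> short_solution h s ->
    forall t, - h <= t <= h -> Rabs (G (s t) - G s0) <= eps.
Proof using f_cont.
intros HG He. destruct (continuous_close G s0 eps HG He) as [d [Hd H]].
destruct (short_solution_stays d Hd) as [h1 [Hh1 Hst]].
exists h1. split; [exact Hh1 |]. intros h s Hh Hs t Ht. apply H, (Hst h s Hh Hs t Ht).
Qed.

(** Because of this symmetry the error is [o(h)], one order better than that of
    a pointwise expansion, and [gr s0 + h ph s0] is visible to order [h]. *)
Lemma second_difference_expansion (X V gr W ph : state -> R) eps :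
  continuous W s0 -> continuous ph s0 ->
  (forall h s, short_solution h s -> forall t, - h <= t <= h ->
     is_derive (fun t => X (s t)) t (V (s t)) /\
     is_derive (fun t => V (s t)) t (gr (s t) + h * ph (s t)) /\
     is_derive (fun t => gr (s t)) t (W (s t))) ->
  0 < eps ->
  exists h1, 0 < h1 /\ forall h s, 0 < h < h1 -> short_solution h s ->
    Rabs ((X (s h) - 2 * X (s 0) + X (s (- h))) / h ^ 2 - (gr s0 + h * ph s0))
    <= eps * h.
Proof using f_cont.
intros HW Hph HD He.
destruct (short_solution_value W (eps / 4) HW ltac:(lra)) as [h1 [Hh1 C1]].
destruct (short_solution_value ph (eps / 4) Hph ltac:(lra)) as [h2 [Hh2 C2]].
exists (Rmin h1 h2). split; [apply Rmin_pos; assumption |].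
intros h s Hh Hs.
assert (k1 := Rmin_l h1 h2). assert (k2 := Rmin_r h1 h2).
specialize (C1 h s ltac:(lra) Hs). specialize (C2 h s ltac:(lra) Hs).
assert (Hinit : s 0 = s0) by apply Hs.
specialize (HD h s Hs).
assert (HB := second_difference_bound (fun t => X (s t)) (fun t => V (s t))
  (fun t => gr (s t) + h * ph (s t)) h (eps * h) ltac:(lra)).
cbv beta in HB.
assert (Hsd : Rabs (X (s h) - 2 * X (s 0) + X (s (- h))
  - h ^ 2 * (gr (s 0) + h * ph (s 0))) <= eps * h * h ^ 2).
{ apply HB.
  - intros t Ht. destruct (HD t Ht) as [D1 [D2 _]]. split; assumption.
  - intros t Ht.
    assert (Hgr : Rabs (gr (s t) + gr (s (- t)) - 2 * gr (s 0)) <= eps / 2 * h).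
    { assert (L1 := linear_expansion_bound (fun t => gr (s t)) (fun t => W (s t))
        (W s0) t (eps / 4) ltac:(lra)). cbv beta in L1.
      assert (L2 := linear_expansion_bound (fun t => gr (s (-1 * t)))
        (fun t => -1 * W (s (-1 * t))) (- W s0) t (eps / 4) ltac:(lra)). cbv beta in L2.
      rewrite Rmult_0_r in L2. replace (-1 * t) with (- t) in L2 by ring.
      assert (L1' : Rabs (gr (s t) - gr (s 0) - t * W s0) <= eps / 4 * t).
      { apply L1; intros r Hr; [apply HD; lra | apply C1; lra]. }
      assert (L2' : Rabs (gr (s (- t)) - gr (s 0) - t * - W s0) <= eps / 4 * t).
      { apply L2; intros r Hr.
        - apply (rate_scaled (fun t => gr (s t))). apply HD. lra.
        - replace (-1 * W (s (-1 * r)) - - W s0) with (- (W (s (-1 * r)) - W s0)) by ring.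
          rewrite Rabs_Ropp. apply C1. lra. }
      replace (gr (s t) + gr (s (- t)) - 2 * gr (s 0)) with
        ((gr (s t) - gr (s 0) - t * W s0) + (gr (s (- t)) - gr (s 0) - t * - W s0)) by ring.
      apply Rle_trans with (1 := Rabs_triang _ _).
      assert (eps / 4 * t <= eps / 4 * h) by (apply Rmult_le_compat_l; lra). lra. }
    assert (c1 := C2 t ltac:(lra)). assert (c2 := C2 (- t) ltac:(lra)).
    rewrite Hinit in *.
    replace (gr (s t) + h * ph (s t) + (gr (s (- t)) + h * ph (s (- t)))
      - 2 * (gr s0 + h * ph s0)) with
      ((gr (s t) + gr (s (- t)) - 2 * gr s0)
       + h * ((ph (s t) - ph s0) + (ph (s (- t)) - ph s0))) by ring.
    apply Rle_trans with (1 := Rabs_triang _ _).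
    rewrite Rabs_mult, (Rabs_pos_eq h) by lra.
    assert (c3 := Rabs_triang (ph (s t) - ph s0) (ph (s (- t)) - ph s0)).
    assert (h * Rabs (ph (s t) - ph s0 + (ph (s (- t)) - ph s0)) <= h * (eps / 2))
      by (apply Rmult_le_compat_l; lra).
    lra. }
rewrite Hinit in *.
replace ((X (s h) - 2 * X s0 + X (s (- h))) / h ^ 2 - (gr s0 + h * ph s0))
  with ((X (s h) - 2 * X s0 + X (s (- h)) - h ^ 2 * (gr s0 + h * ph s0)) * / h ^ 2)
  by (field; lra).
assert (Hp : 0 < h ^ 2) by (apply pow_lt; lra).
rewrite Rabs_mult, (Rabs_pos_eq (/ h ^ 2)) by (left; apply Rinv_0_lt_compat, Hp).
apply Rmult_le_reg_r with (h ^ 2); [exact Hp |].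
rewrite Rmult_assoc, Rinv_l, Rmult_1_r by lra. exact Hsd.
Qed.

Lemma short_solution_rates h s : short_solution h s ->
  forall t, - h <= t <= h -> fst (s t) <> (0, 0) /\
  moves s t (grav1 (s t) + h * fst (f 1%nat (s t)))
            (grav2 (s t) + h * snd (f 1%nat (s t))).
Proof using f_zero.
intros [_ Hs] t Ht. destruct (Hs t Ht) as [Hn Hm].
rewrite truncation_one, (f_zero _ Hn) in Hm. split; assumption.
Qed.

Definition second_difference (X : state -> R) (h : R) (s : R -> state) : R :=
  (X (s h) - 2 * X (s 0) + X (s (- h))) / h ^ 2.

(** The second difference is gravity plus [h f1 + o(h)] and the residual is
    [O(h^2)], so that the terms of order [h] have to match. The sign [k] is for
    discrete Euler-Lagrange equations, whose leading term is [- x'']. *)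
Lemma order_one_identified (Psi : R * R -> R * R -> R * R -> R -> R * R)
    (k m1 m2 C h0 : R) :
  k = 1 \/ k = -1 -> 0 < h0 ->
  (forall h, 0 < h < h0 -> exists s, short_solution h s /\
     enorm (Psi (fst (s (- h))) (fst (s 0)) (fst (s h)) h) <= C * h ^ 2) ->
  (forall eps, 0 < eps -> exists h1, 0 < h1 /\ forall h s, 0 < h < h1 ->
     short_solution h s ->
     Rabs (k * fst (Psi (fst (s (- h))) (fst (s 0)) (fst (s h)) h)
           - (second_difference X1 h s - grav1 s0 - h * m1)) <= eps * h /\
     Rabs (k * snd (Psi (fst (s (- h))) (fst (s 0)) (fst (s h)) h)
           - (second_difference X2 h s - grav2 s0 - h * m2)) <= eps * h) ->
  f 1%nat s0 = (m1, m2).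
Proof using H0 f_cont f_zero.
intros Hk Hh0 Hsol Hexp.
assert (Hr := rad_pos s0 H0).
assert (Hsmall : forall a, (forall eps, 0 < eps -> exists h1, 0 < h1 /\
  forall h, 0 < h < h1 -> Rabs (h * a) <= C * h ^ 2 + eps * h) -> a = 0).
{ intros a Ha. apply NNPP. intro Hne. apply Rabs_pos_lt in Hne.
  destruct (Ha (Rabs a / 4) ltac:(lra)) as [h1 [Hh1 H]].
  assert (HC := Rabs_pos C).
  assert (Hq : 0 < Rabs a / (4 * (Rabs C + 1))) by (apply Rdiv_lt_0_compat; lra).
  set (h := Rmin (h1 / 2) (Rabs a / (4 * (Rabs C + 1)))).
  assert (Hhp : 0 < h) by (apply Rmin_pos; lra).
  assert (q1 : h <= h1 / 2) by apply Rmin_l.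
  assert (q2 : h <= Rabs a / (4 * (Rabs C + 1))) by apply Rmin_r.
  specialize (H h ltac:(lra)). rewrite Rabs_mult, (Rabs_pos_eq h) in H by lra.
  assert (HCh : C * h <= Rabs a / 4).
  { apply Rle_trans with ((Rabs C + 1) * (Rabs a / (4 * (Rabs C + 1)))).
    - assert (C <= Rabs C) by apply Rle_abs. nra.
    - right. field. lra. }
  assert (Rabs a <= C * h + Rabs a / 4).
  { apply Rmult_le_reg_l with h; [exact Hhp |]. lra. }
  lra. }
assert (Hmain : forall (X V gr W ph : state -> R) (m : R) (c : R * R -> R),
  (forall p, Rabs (c p) <= enorm p) ->
  continuous W s0 -> continuous ph s0 ->
  (forall h s, short_solution h s -> forall t, - h <= t <= h ->
     is_derive (fun t => X (s t)) t (V (s t)) /\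
     is_derive (fun t => V (s t)) t (gr (s t) + h * ph (s t)) /\
     is_derive (fun t => gr (s t)) t (W (s t))) ->
  (forall eps, 0 < eps -> exists h1, 0 < h1 /\ forall h s, 0 < h < h1 ->
     short_solution h s ->
     Rabs (k * c (Psi (fst (s (- h))) (fst (s 0)) (fst (s h)) h)
           - (second_difference X h s - gr s0 - h * m)) <= eps * h) ->
  ph s0 = m).
{ intros X V gr W ph m c Hc HW Hph HD Hx.
  apply Rminus_diag_uniq, Hsmall. intros eps He.
  destruct (second_difference_expansion X V gr W ph (eps / 2) HW Hph HD ltac:(lra))
    as [h1 [Hh1 E1]].
  destruct (Hx (eps / 2) ltac:(lra)) as [h2 [Hh2 E2]].
  exists (Rmin h0 (Rmin h1 h2)). split; [repeat apply Rmin_pos; assumption |].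
  intros h Hh.
  assert (q1 := Rmin_l h0 (Rmin h1 h2)). assert (q2 := Rmin_r h0 (Rmin h1 h2)).
  assert (q3 := Rmin_l h1 h2). assert (q4 := Rmin_r h1 h2).
  destruct (Hsol h ltac:(lra)) as [s [Hs HP]].
  specialize (E1 h s ltac:(lra) Hs). specialize (E2 h s ltac:(lra) Hs).
  fold (second_difference X h s) in E1.
  revert HP E2. set (P := Psi _ _ _ _). intros HP E2.
  assert (HcP : Rabs (k * c P) <= C * h ^ 2).
  { apply Rle_trans with (2 := HP). apply Rle_trans with (2 := Hc P).
    rewrite Rabs_mult. destruct Hk as [-> | ->];
      [rewrite Rabs_R1 | rewrite (Rabs_left (-1)) by lra]; lra. }
  apply Rabs_le_between in HcP. apply Rabs_le_between in E1.
  apply Rabs_le_between in E2. apply Rabs_le. lra. }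
assert (Hfst : forall p : R * R, Rabs (fst p) <= enorm p).
{ intro p. unfold enorm. rewrite <- (sqrt_pow2 (Rabs (fst p))) by apply Rabs_pos.
  apply sqrt_le_1_alt. rewrite pow2_abs. assert (q := pow2_ge_0 (snd p)). lra. }
assert (Hsnd : forall p : R * R, Rabs (snd p) <= enorm p).
{ intro p. unfold enorm. rewrite <- (sqrt_pow2 (Rabs (snd p))) by apply Rabs_pos.
  apply sqrt_le_1_alt. rewrite pow2_abs. assert (q := pow2_ge_0 (fst p)). lra. }
rewrite (surjective_pairing (f 1%nat s0)). f_equal.
- apply (Hmain X1 V1 grav1 (fun s => 3 * X1 s * (X1 s * V1 s + X2 s * V2 s) / rad s ^ 5
     - V1 s / rad s ^ 3) (fun s => fst (f 1%nat s)) m1 fst Hfst).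
  + apply loc_lip_continuous. loc_lips; apply pow_nonzero; lra.
  + apply f_cont.
  + intros h s Hs t Ht. destruct (short_solution_rates h s Hs t Ht) as [Hn Hm].
    split; [apply Hm |]. split; [apply Hm |].
    apply (grav1_rate _ _ _ _ Hm Hn).
  + intros eps He. destruct (Hexp eps He) as [h1 [Hh1 H]].
    exists h1. split; [exact Hh1 |]. intros h s Hh Hs. apply (H h s Hh Hs).
- apply (Hmain X2 V2 grav2 (fun s => 3 * X2 s * (X1 s * V1 s + X2 s * V2 s) / rad s ^ 5
     - V2 s / rad s ^ 3) (fun s => snd (f 1%nat s)) m2 snd Hsnd).
  + apply loc_lip_continuous. loc_lips; apply pow_nonzero; lra.
  + apply f_cont.
  + intros h s Hs t Ht. destruct (short_solution_rates h s Hs t Ht) as [Hn Hm].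
    split; [apply Hm |]. split; [apply Hm |].
    apply (grav2_rate _ _ _ _ Hm Hn).
  + intros eps He. destruct (Hexp eps He) as [h1 [Hh1 H]].
    exists h1. split; [exact Hh1 |]. intros h s Hh Hs. apply (H h s Hh Hs).
Qed.

End ShortTime.

(** * The two integrators *)

Lemma phi_rates a b : (a, b) <> (0, 0) ->
  is_derive (fun u => phi (u, b)) a (a / sqrt (a ^ 2 + b ^ 2) ^ 3) /\
  is_derive (fun u => phi (a, u)) b (b / sqrt (a ^ 2 + b ^ 2) ^ 3).
Proof.
intro H. assert (Hp := sumsq_pos _ H). simpl fst in Hp; simpl snd in Hp.
assert (Hs := sqrt_lt_R0 _ Hp).
unfold phi, enorm. simpl fst; simpl snd.
assert (Hp' : 0 < a * (a * 1) + b * (b * 1)) by lra.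
split; auto_derive.
1, 3: repeat split; trivial; apply Rgt_not_eq, sqrt_lt_R0, Hp'.
all: change (a * (a * 1)) with (a ^ 2); change (b * (b * 1)) with (b ^ 2);
  field; lra.
Qed.

Lemma grad_phi s : fst s <> (0, 0) -> grad phi (fst s) = (- grav1 s, - grav2 s).
Proof.
destruct s as [[a b] v]. intro H. cbn [fst] in *.
destruct (phi_rates a b H) as [D1 D2].
apply (f_equal2 pair).
- unfold grav1. rewrite Ropp_involutive. apply is_derive_unique, D1.
- unfold grav2. rewrite Ropp_involutive. apply is_derive_unique, D2.
Qed.

Lemma locally_nonzero_fst a b : (a, b) <> (0, 0) ->
  locally a (fun u : R => (u, b) <> (0, 0)).
Proof.
intro H. destruct (Req_dec b 0) as [-> | Hb].
- assert (Ha : a <> 0) by (intros ->; apply H; reflexivity).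
  exists (mkposreal (Rabs a) (Rabs_pos_lt a Ha)). intros u Hu Hz.
  injection Hz as Hz. change (Rabs (u - a) < Rabs a) in Hu. rewrite Hz in Hu.
  replace (0 - a) with (- a) in Hu by ring. rewrite Rabs_Ropp in Hu. lra.
- exists (mkposreal 1 Rlt_0_1). intros u _ Hz. injection Hz as _ Hz. contradiction.
Qed.

Lemma locally_nonzero_snd a b : (a, b) <> (0, 0) ->
  locally b (fun u : R => (a, u) <> (0, 0)).
Proof.
intro H. destruct (locally_nonzero_fst b a) as [d Hd].
- intro Hz. injection Hz as -> ->. apply H. reflexivity.
- exists d. intros u Hu Hz. apply (Hd u Hu). injection Hz as -> ->. reflexivity.
Qed.

(** The velocity [v] only completes positions to states. *)
Lemma split_discrete_euler_lagrange (phi1 phi2 : R * R -> R) (xm x xp : R * R) h :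
  (forall x, x <> (0, 0) -> phi x = phi1 x + phi2 x) ->
  (forall x, x <> (0, 0) -> phi1 x = phi2 x) ->
  h <> 0 -> x <> (0, 0) -> (fst x, snd xm) <> (0, 0) -> (fst xp, snd x) <> (0, 0) ->
  forall v, discrete_euler_lagrange (split_lagrangian phi1 phi2) xm x xp h =
  (- ((fst xp - 2 * fst x + fst xm) / h ^ 2
      - / 2 * (grav1 (fst x, snd xm, v) + grav1 (x, v))),
   - ((snd xp - 2 * snd x + snd xm) / h ^ 2
      - / 2 * (grav2 (fst xp, snd x, v) + grav2 (x, v)))).
Proof.
destruct xm as [m1 m2], x as [x1 x2], xp as [p1 p2]. cbn [fst snd].
intros Hsum Heq Hh Hx Hm Hp v.
assert (P1 : forall q, q <> (0, 0) -> phi1 q = / 2 * phi q).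
{ intros q Hq. rewrite (Hsum q Hq), <- (Heq q Hq). field. }
assert (P2 : forall q, q <> (0, 0) -> phi2 q = / 2 * phi q).
{ intros q Hq. rewrite (Hsum q Hq), (Heq q Hq). field. }
assert (Hk : forall a b c d, enorm (minus (a, b) (c, d)) ^ 2 = (a - c) ^ 2 + (b - d) ^ 2).
{ intros. rewrite enorm_sq. reflexivity. }
assert (E1 : Derive (fun u => split_lagrangian phi1 phi2 (u, x2) (p1, p2) h) x1
  = - ((p1 - x1) / h ^ 2)).
{ apply is_derive_unique.
  apply (is_derive_ext (fun u => / 2 * (((p1 - u) ^ 2 + (p2 - x2) ^ 2) / h ^ 2)
    - (phi1 (p1, x2) + phi2 (p1, p2)))).
  - intro u. unfold split_lagrangian. rewrite Hk. reflexivity.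
  - eapply is_derive_value; [rates; apply pow_nonzero, Hh |].
    simpl. field. exact Hh. }
assert (E2 : Derive (fun u => split_lagrangian phi1 phi2 (x1, u) (p1, p2) h) x2
  = - ((p2 - x2) / h ^ 2) + / 2 * grav2 (p1, x2, v)).
{ apply is_derive_unique.
  apply (is_derive_ext_loc (fun u => / 2 * (((p1 - x1) ^ 2 + (p2 - u) ^ 2) / h ^ 2)
    - (/ 2 * phi (p1, u) + phi2 (p1, p2)))).
  - apply (filter_imp _ _ (fun u Hu => eq_sym (f_equal2 Rminus
      (f_equal (fun q => / 2 * (q / h ^ 2)) (Hk p1 p2 x1 u))
      (f_equal (fun q => q + phi2 (p1, p2)) (P1 (p1, u) Hu))))).
    apply locally_nonzero_snd, Hp.
  - destruct (phi_rates _ _ Hp) as [_ D].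
    eapply is_derive_value; [rates; apply pow_nonzero, Hh |].
    unfold grav2. change (rad (p1, x2, v)) with (sqrt (p1 ^ 2 + x2 ^ 2)).
    change (X2 (p1, x2, v)) with x2. unfold Rdiv.
    generalize (/ sqrt (p1 ^ 2 + x2 ^ 2) ^ 3). intro g.
    simpl. field. exact Hh. }
assert (E3 : Derive (fun u => split_lagrangian phi1 phi2 (m1, m2) (u, x2) h) x1
  = (x1 - m1) / h ^ 2 + / 2 * (grav1 (x1, m2, v) + grav1 (x1, x2, v))).
{ apply is_derive_unique.
  apply (is_derive_ext_loc (fun u => / 2 * (((u - m1) ^ 2 + (x2 - m2) ^ 2) / h ^ 2)
    - (/ 2 * phi (u, m2) + / 2 * phi (u, x2)))).
  - apply (filter_imp (fun u => (u, m2) <> (0, 0) /\ (u, x2) <> (0, 0))).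
    + intros u [Hu1 Hu2]. unfold split_lagrangian. cbn [fst snd].
      rewrite Hk, (P1 _ Hu1), (P2 _ Hu2). reflexivity.
    + apply filter_and; apply locally_nonzero_fst; assumption.
  - destruct (phi_rates _ _ Hm) as [D _]. destruct (phi_rates _ _ Hx) as [D' _].
    eapply is_derive_value; [rates; apply pow_nonzero, Hh |].
    unfold grav1. change (rad (x1, m2, v)) with (sqrt (x1 ^ 2 + m2 ^ 2)).
    change (rad (x1, x2, v)) with (sqrt (x1 ^ 2 + x2 ^ 2)).
    change (X1 (x1, m2, v)) with x1. change (X1 (x1, x2, v)) with x1. unfold Rdiv.
    generalize (/ sqrt (x1 ^ 2 + x2 ^ 2) ^ 3). intro g.
    generalize (/ sqrt (x1 ^ 2 + m2 ^ 2) ^ 3). intro g'.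
    simpl. field. exact Hh. }
assert (E4 : Derive (fun u => split_lagrangian phi1 phi2 (m1, m2) (x1, u) h) x2
  = (x2 - m2) / h ^ 2 + / 2 * grav2 (x1, x2, v)).
{ apply is_derive_unique.
  apply (is_derive_ext_loc (fun u => / 2 * (((x1 - m1) ^ 2 + (u - m2) ^ 2) / h ^ 2)
    - (phi1 (x1, m2) + / 2 * phi (x1, u)))).
  - apply (filter_imp (fun u => (x1, u) <> (0, 0))).
    + intros u Hu. unfold split_lagrangian. cbn [fst snd].
      rewrite Hk, (P2 _ Hu). reflexivity.
    + apply locally_nonzero_snd, Hx.
  - destruct (phi_rates _ _ Hx) as [_ D].
    eapply is_derive_value; [rates; apply pow_nonzero, Hh |].
    unfold grav2. change (rad (x1, x2, v)) with (sqrt (x1 ^ 2 + x2 ^ 2)).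
    change (X2 (x1, x2, v)) with x2. unfold Rdiv.
    generalize (/ sqrt (x1 ^ 2 + x2 ^ 2) ^ 3). intro g.
    simpl. field. exact Hh. }
unfold discrete_euler_lagrange, grad. cbn [fst snd].
rewrite E1, E2, E3, E4.
match goal with |- plus (?a, ?b) (?c, ?d) = _ =>
  transitivity (a + c, b + d); [reflexivity |] end.
apply (f_equal2 pair); field; exact Hh.
Qed.

Section Identification.

Variables (Psi : R * R -> R * R -> R * R -> R -> R * R)
  (f : nat -> state -> R * R).
Hypothesis Hmod : modified_equation Psi f.

Lemma modified_continuous j s : fst s <> (0, 0) ->
  continuous (fun s => fst (f j s)) s /\ continuous (fun s => snd (f j s)) s.
Proof using Hmod.
intro H. destruct Hmod as [Hs _]. destruct (Hs j O) as [H1 H2].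
split; [apply H1 | apply H2]; exact H.
Qed.

Lemma modified_order_zero s : fst s <> (0, 0) -> f O s = (grav1 s, grav2 s).
Proof using Hmod.
intro H. destruct Hmod as [_ [H0 _]]. rewrite (H0 s H), (grad_phi s H).
transitivity (- - grav1 s, - - grav2 s); [reflexivity |].
rewrite !Ropp_involutive. reflexivity.
Qed.

Lemma modified_short_solutions s0 : fst s0 <> (0, 0) ->
  exists C h0, 0 < h0 /\ forall h, 0 < h < h0 -> exists s, short_solution f s0 h s /\
     enorm (Psi (fst (s (- h))) (fst (s 0)) (fst (s h)) h) <= C * h ^ 2.
Proof using Hmod.
intro H. destruct Hmod as [_ [_ H1]].
destruct (H1 1%nat (fst s0) (snd s0) H) as [C [h0 [Hh0 Hsol]]].
exists C, h0. split; [exact Hh0 |]. intros h Hh.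
destruct (Hsol h Hh) as [x [v [Hxv [Hx [Hv HP]]]]].
exists (fun t => (x t, v t)). split; [| exact HP].
split.
- rewrite Hx, Hv. symmetry. apply surjective_pairing.
- intros t Ht. exact (solves_moves _ _ _ _ t Hxv Ht).
Qed.

Lemma modified_order_one (k : R) (m1 m2 : state -> R) :
  k = 1 \/ k = -1 ->
  (forall s0, fst s0 <> (0, 0) ->
   forall eps, 0 < eps -> exists h1, 0 < h1 /\ forall h s, 0 < h < h1 ->
     short_solution f s0 h s ->
     Rabs (k * fst (Psi (fst (s (- h))) (fst (s 0)) (fst (s h)) h)
           - (second_difference X1 h s - grav1 s0 - h * m1 s0)) <= eps * h /\
     Rabs (k * snd (Psi (fst (s (- h))) (fst (s 0)) (fst (s h)) h)
           - (second_difference X2 h s - grav2 s0 - h * m2 s0)) <= eps * h) ->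
  forall s, fst s <> (0, 0) -> f 1%nat s = (m1 s, m2 s).
Proof using Hmod.
intros Hk Hexp s0 H0.
destruct (modified_short_solutions s0 H0) as [C [h0 [Hh0 Hsol]]].
apply (order_one_identified f s0 H0 (fun j => modified_continuous j s0 H0)
  modified_order_zero Psi k (m1 s0) (m2 s0) C h0 Hk Hh0 Hsol (Hexp s0 H0)).
Qed.

End Identification.

(** The residual is exactly the second difference minus gravity, whence the
    coefficient 0. *)
Lemma symplectic_euler_magnetic f :
  modified_equation symplectic_euler f -> magnetic_order_one 0 f.
Proof.
intro Hmod.
split; [exact (modified_continuous _ _ Hmod) |].
split; [exact (modified_order_zero _ _ Hmod) |].
apply (modified_order_one _ _ Hmod 1); [left; reflexivity |].
intros s0 H0 eps He. exists 1. split; [lra |].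
intros h s Hh [Hinit _].
assert (Hg := grad_phi s0 H0).
rewrite Hinit. unfold symplectic_euler, second_difference. rewrite Hg, Hinit.
assert (Hz : forall a b : R, a = b -> Rabs (a - b) <= eps * h).
{ intros a b ->. unfold Rminus. rewrite Rplus_opp_r, Rabs_R0. nra. }
split; apply Hz.
- change (1 * (/ h ^ 2 * (X1 (s h) + - (2 * X1 s0) + X1 (s (- h))) + - grav1 s0)
    = (X1 (s h) - 2 * X1 s0 + X1 (s (- h))) / h ^ 2 - grav1 s0 - h * (0 * mag1 s0)).
  field. lra.
- change (1 * (/ h ^ 2 * (X2 (s h) + - (2 * X2 s0) + X2 (s (- h))) + - grav2 s0)
    = (X2 (s h) - 2 * X2 s0 + X2 (s (- h))) / h ^ 2 - grav2 s0 - h * (0 * mag2 s0)).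
  field. lra.
Qed.

Section MixedPoints.

Variables (f : nat -> state -> R * R) (s0 : state).
Hypothesis H0 : fst s0 <> (0, 0).
Hypothesis f_cont : forall j,
  continuous (fun s => fst (f j s)) s0 /\ continuous (fun s => snd (f j s)) s0.

Lemma nonzero_nearby (s1 : state) : fst s1 <> (0, 0) ->
  exists d, 0 < d /\ forall s, ball s1 d s -> fst s <> (0, 0).
Proof using.
intro H. assert (Hp := sumsq_pos _ H).
change (0 < X1 s1 ^ 2 + X2 s1 ^ 2) in Hp.
assert (HG : loc_lip (fun s => X1 s ^ 2 + X2 s ^ 2) s1) by loc_lips.
destruct (loc_lip_close _ _ ((X1 s1 ^ 2 + X2 s1 ^ 2) / 2) HG) as [d [Hd Hb]].
- lra.
- exists d. split; [exact Hd |]. intros s Hs. specialize (Hb s Hs).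
  apply Rabs_le_between in Hb. apply nonzero_of_sumsq.
  change (0 < X1 s ^ 2 + X2 s ^ 2). lra.
Qed.

(** The force is evaluated at a point that has one coordinate at time [0] and
    the other at time [- h]; only the latter contributes to its expansion. *)
Lemma grav1_mixed eps : 0 < eps ->
  exists h1, 0 < h1 /\ forall h s, 0 < h < h1 -> short_solution f s0 h s ->
    (X1 s0, X2 (s (- h))) <> (0, 0) /\
    forall v, Rabs (grav1 (X1 s0, X2 (s (- h)), v) - grav1 s0
                    - h * (-3 * cross s0 * V2 s0)) <= eps * h.
Proof using H0 f_cont.
intro He.
set (G := fun s => 3 * X1 s * (X1 s * V1 s + X2 s * V2 s) / rad s ^ 5
                   - V1 s / rad s ^ 3).
set (s1 := (X1 s0, X2 s0, (0, -1 * V2 s0)) : state).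
assert (Hn1 : fst s1 <> (0, 0)) by (apply nonzero_of_sumsq; exact (sumsq_pos _ H0)).
assert (Hr := rad_pos s1 Hn1).
assert (HG : loc_lip G s1) by (unfold G; loc_lips; apply pow_nonzero; lra).
destruct (loc_lip_close _ _ eps HG He) as [d1 [Hd1 C1]].
destruct (nonzero_nearby s1 Hn1) as [d2 [Hd2 C2]].
destruct (short_solution_stays f s0 f_cont (Rmin d1 d2)) as [h1 [Hh1 Hst]];
  [apply Rmin_pos; assumption |].
exists h1. split; [exact Hh1 |]. intros h s Hh Hs.
specialize (Hst h s Hh Hs).
assert (Hinit : s 0 = s0) by apply Hs.
set (q := fun t => (X1 s0, X2 (s (-1 * t)), (0, -1 * V2 (s (-1 * t)))) : state).
assert (Hq : forall t, 0 <= t <= h -> ball s1 (Rmin d1 d2) (q t)).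
{ intros t Ht. assert (Hb := Hst (-1 * t) ltac:(lra)).
  apply ball_state in Hb. destruct Hb as [_ [b2 [_ b4]]].
  apply ball_state.
  change (Rabs (X1 s0 - X1 s0) < Rmin d1 d2 /\
    Rabs (X2 (s (-1 * t)) - X2 s0) < Rmin d1 d2 /\
    Rabs (0 - 0) < Rmin d1 d2 /\
    Rabs (-1 * V2 (s (-1 * t)) - -1 * V2 s0) < Rmin d1 d2).
  assert (Hm : 0 < Rmin d1 d2) by (apply Rmin_pos; assumption).
  replace (-1 * V2 (s (-1 * t)) - -1 * V2 s0) with (- (V2 (s (-1 * t)) - V2 s0)) by ring.
  rewrite Rabs_Ropp. unfold Rminus. rewrite !Rplus_opp_r, Rabs_R0. tauto. }
assert (Hqn : forall t, 0 <= t <= h -> fst (q t) <> (0, 0)).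
{ intros t Ht. apply C2. eapply ball_state_le; [apply Rmin_r | apply Hq, Ht]. }
assert (E := linear_expansion_bound (fun t => grav1 (q t)) (fun t => G (q t)) (G s1)
  h eps ltac:(lra)). cbv beta in E.
split.
- assert (E' := Hqn h ltac:(lra)). unfold q in E'.
  replace (- h) with (-1 * h) by ring. exact E'.
- intro v.
  replace (-3 * cross s0 * V2 s0) with (G s1).
  + replace (grav1 (X1 s0, X2 (s (- h)), v)) with (grav1 (q h)).
    2: { unfold q. replace (-1 * h) with (- h) by ring. reflexivity. }
    replace (grav1 s0) with (grav1 (q 0)).
    2: { unfold q. rewrite Rmult_0_r, Hinit. reflexivity. }
    apply E.
    * intros t Ht. destruct Hs as [_ Hs]. destruct (Hs (-1 * t) ltac:(lra)) as [_ Hm].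
      destruct Hm as [_ [D2 [_ D4]]].
      apply (rate_scaled (fun t => X2 (s t))) in D2.
      apply (rate_scaled (fun t => V2 (s t))) in D4.
      assert (Hmq : moves q t 0
        (-1 * (-1 * snd (truncation f 1 h (s (-1 * t)))))).
      { split; [exact (rate_const (X1 s0) t) |]. split; [exact D2 |].
        split; [exact (rate_const 0 t) |].
        eapply is_derive_value; [apply (rate_mult (fun _ => -1) (fun t => V2 (s (-1 * t))));
          [apply rate_const | exact D4] | ring]. }
      apply (grav1_rate q t _ _ Hmq (Hqn t Ht)).
    * intros t Ht. apply C1. eapply ball_state_le; [apply Rmin_l | apply Hq, Ht].
  + unfold G, cross. change (rad s1) with (rad s0) in *.
    change (X1 s1) with (X1 s0). change (X2 s1) with (X2 s0).
    change (V1 s1) with 0. change (V2 s1) with (-1 * V2 s0). field. lra.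
Qed.

(** Here the shift is forward in time, which gives the opposite sign. *)
Lemma grav2_mixed eps : 0 < eps ->
  exists h1, 0 < h1 /\ forall h s, 0 < h < h1 -> short_solution f s0 h s ->
    (X1 (s h), X2 s0) <> (0, 0) /\
    forall v, Rabs (grav2 (X1 (s h), X2 s0, v) - grav2 s0
                    - h * (3 * cross s0 * V1 s0)) <= eps * h.
Proof using H0 f_cont.
intro He.
set (G := fun s => 3 * X2 s * (X1 s * V1 s + X2 s * V2 s) / rad s ^ 5
                   - V2 s / rad s ^ 3).
set (s1 := (X1 s0, X2 s0, (V1 s0, 0)) : state).
assert (Hn1 : fst s1 <> (0, 0)) by (apply nonzero_of_sumsq; exact (sumsq_pos _ H0)).
assert (Hr := rad_pos s1 Hn1).
assert (HG : loc_lip G s1) by (unfold G; loc_lips; apply pow_nonzero; lra).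
destruct (loc_lip_close _ _ eps HG He) as [d1 [Hd1 C1]].
destruct (nonzero_nearby s1 Hn1) as [d2 [Hd2 C2]].
destruct (short_solution_stays f s0 f_cont (Rmin d1 d2)) as [h1 [Hh1 Hst]];
  [apply Rmin_pos; assumption |].
exists h1. split; [exact Hh1 |]. intros h s Hh Hs.
specialize (Hst h s Hh Hs).
assert (Hinit : s 0 = s0) by apply Hs.
set (q := fun t => (X1 (s t), X2 s0, (V1 (s t), 0)) : state).
assert (Hq : forall t, 0 <= t <= h -> ball s1 (Rmin d1 d2) (q t)).
{ intros t Ht. assert (Hb := Hst t ltac:(lra)).
  apply ball_state in Hb. destruct Hb as [b1 [_ [b3 _]]].
  apply ball_state.
  change (Rabs (X1 (s t) - X1 s0) < Rmin d1 d2 /\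
    Rabs (X2 s0 - X2 s0) < Rmin d1 d2 /\
    Rabs (V1 (s t) - V1 s0) < Rmin d1 d2 /\ Rabs (0 - 0) < Rmin d1 d2).
  assert (Hm : 0 < Rmin d1 d2) by (apply Rmin_pos; assumption).
  unfold Rminus in *. rewrite !Rplus_opp_r, Rabs_R0. tauto. }
assert (Hqn : forall t, 0 <= t <= h -> fst (q t) <> (0, 0)).
{ intros t Ht. apply C2. eapply ball_state_le; [apply Rmin_r | apply Hq, Ht]. }
assert (E := linear_expansion_bound (fun t => grav2 (q t)) (fun t => G (q t)) (G s1)
  h eps ltac:(lra)). cbv beta in E.
split; [apply (Hqn h); lra |].
intro v.
replace (3 * cross s0 * V1 s0) with (G s1).
- change (grav2 (X1 (s h), X2 s0, v)) with (grav2 (q h)).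
  replace (grav2 s0) with (grav2 (q 0)) by (unfold q; rewrite Hinit; reflexivity).
  apply E.
  + intros t Ht. destruct Hs as [_ Hs]. destruct (Hs t ltac:(lra)) as [_ Hm].
    destruct Hm as [D1 [_ [D3 _]]].
    assert (Hmq : moves q t (fst (truncation f 1 h (s t))) 0).
    { split; [exact D1 |]. split; [exact (rate_const (X2 s0) t) |].
      split; [exact D3 | exact (rate_const 0 t)]. }
    apply (grav2_rate q t _ _ Hmq (Hqn t Ht)).
  + intros t Ht. apply C1. eapply ball_state_le; [apply Rmin_l | apply Hq, Ht].
- unfold G, cross. change (rad s1) with (rad s0) in *.
  change (X1 s1) with (X1 s0). change (X2 s1) with (X2 s0).
  change (V1 s1) with (V1 s0). change (V2 s1) with 0. field. lra.
Qed.

End MixedPoints.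

(** The discrete force is the mean of gravity at [x_n] and at points with one
    coordinate shifted by a time step, backwards in the first component and
    forwards in the second; half of the change caused by these opposite shifts
    is the magnetic force. *)
Lemma split_lagrangian_magnetic (phi1 phi2 : R * R -> R) f :
  (forall x, x <> (0, 0) -> phi x = phi1 x + phi2 x) ->
  (forall x, x <> (0, 0) -> phi1 x = phi2 x) ->
  modified_equation (discrete_euler_lagrange (split_lagrangian phi1 phi2)) f ->
  magnetic_order_one 1 f.
Proof.
intros Hsum Heq Hmod.
split; [exact (modified_continuous _ _ Hmod) |].
split; [exact (modified_order_zero _ _ Hmod) |].
apply (modified_order_one _ _ Hmod (-1)); [right; reflexivity |].
intros s0 H0 eps He.
assert (Hc := fun j => modified_continuous _ _ Hmod j s0 H0).
destruct (grav1_mixed f s0 H0 Hc eps He) as [h1 [Hh1 G1]].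
destruct (grav2_mixed f s0 H0 Hc eps He) as [h2 [Hh2 G2]].
exists (Rmin h1 h2). split; [apply Rmin_pos; assumption |].
intros h s Hh Hs.
assert (k1 := Rmin_l h1 h2). assert (k2 := Rmin_r h1 h2).
destruct (G1 h s ltac:(lra) Hs) as [N1 E1].
destruct (G2 h s ltac:(lra) Hs) as [N2 E2].
assert (Hinit : s 0 = s0) by apply Hs.
specialize (E1 (snd s0)). specialize (E2 (snd s0)).
unfold second_difference. rewrite Hinit.
rewrite (split_discrete_euler_lagrange phi1 phi2 _ _ _ h Hsum Heq
  ltac:(lra) H0 N1 N2 (snd s0)).
cbn [fst snd]. rewrite <- (surjective_pairing s0).
fold (X1 s0) (X1 (s h)) (X1 (s (- h))) (X2 s0) (X2 (s h)) (X2 (s (- h))).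
assert (Hhalf : forall a b, Rabs b <= eps * h -> a = / 2 * b -> Rabs a <= eps * h).
{ intros a b Hb ->. rewrite Rabs_mult, (Rabs_pos_eq (/ 2)) by lra.
  assert (q := Rabs_pos b). lra. }
split.
- rewrite <- Rabs_Ropp. apply (Hhalf _ _ E1). unfold mag1. field. lra.
- rewrite <- Rabs_Ropp. apply (Hhalf _ _ E2). unfold mag2. field. lra.
Qed.

(** * Norm and polar angle of the LRL vector *)

Lemma enorm_lipschitz a b :
  Rabs (enorm a - enorm b) <= Rabs (fst a - fst b) + Rabs (snd a - snd b).
Proof.
assert (Hone : forall a b, enorm a <= enorm b + (Rabs (fst a - fst b) + Rabs (snd a - snd b))).
{ clear. intros a b.
  set (p := Rabs (fst a - fst b)). set (q := Rabs (snd a - snd b)).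
  assert (Hp : 0 <= p) by apply Rabs_pos. assert (Hq : 0 <= q) by apply Rabs_pos.
  assert (HN : 0 <= enorm b) by apply sqrt_pos.
  assert (Hb := enorm_sq b). set (N := enorm b) in *.
  assert (b1 : Rabs (fst b) <= N).
  { apply abs_le_of_sq; [exact HN |]. assert (w := pow2_ge_0 (snd b)). lra. }
  assert (b2 : Rabs (snd b) <= N).
  { apply abs_le_of_sq; [exact HN |]. assert (w := pow2_ge_0 (fst b)). lra. }
  unfold enorm. rewrite <- (sqrt_pow2 (N + (p + q))) by lra.
  apply sqrt_le_1_alt.
  assert (Hp2 : (fst a - fst b) ^ 2 = p ^ 2) by (unfold p; rewrite pow2_abs; ring).
  assert (Hq2 : (snd a - snd b) ^ 2 = q ^ 2) by (unfold q; rewrite pow2_abs; ring).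
  assert (m1 : fst b * (fst a - fst b) <= N * p).
  { apply Rle_trans with (1 := Rle_abs _). rewrite Rabs_mult.
    apply Rmult_le_compat; try apply Rabs_pos; [exact b1 | apply Rle_refl]. }
  assert (m2 : snd b * (snd a - snd b) <= N * q).
  { apply Rle_trans with (1 := Rle_abs _). rewrite Rabs_mult.
    apply Rmult_le_compat; try apply Rabs_pos; [exact b2 | apply Rle_refl]. }
  assert (0 <= p * q) by nra. nra. }
assert (h1 := Hone a b). assert (h2 := Hone b a).
rewrite (Rabs_minus_sym (fst b)), (Rabs_minus_sym (snd b)) in h2.
apply Rabs_le. lra.
Qed.

(** While its cosine stays positive, a continuous angle cannot wind. *)
Lemma angle_small (om : R -> R) (T : R) : 0 <= T ->
  (forall t, 0 <= t <= T ->
     filterlim om (within (fun s => 0 <= s <= T) (locally t)) (locally (om t))) ->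
  (forall t, 0 <= t <= T -> 0 < cos (om t - om 0)) ->
  Rabs (om T - om 0) < PI / 2.
Proof.
intros HT Hcont Hcos. assert (HPI := PI_RGT_0).
apply (real_induction (fun t => Rabs (om t - om 0) < PI / 2) T HT).
- unfold Rminus. rewrite Rplus_opp_r, Rabs_R0. lra.
- intros t Ht.
  destruct (Hcont t Ht (ball (om t) (PI / 4))) as [d Hd].
  { assert (Hq : 0 < PI / 4) by lra. apply (locally_ball (om t) (mkposreal _ Hq)). }
  exists d. split; [apply cond_pos |].
  intros u w Hu Huw Hw Hu0 HwT Pu.
  assert (Hclose : forall r, t - d < r < t + d -> 0 <= r <= T ->
            Rabs (om r - om t) < PI / 4).
  { intros r Hr HrT. apply (Hd r); [| exact HrT].
    change (Rabs (r - t) < d). apply Rabs_def1; lra. }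
  assert (c1 := Hclose u ltac:(lra) ltac:(lra)).
  assert (c2 := Hclose w ltac:(lra) ltac:(lra)).
  assert (c3 := Hcos w ltac:(lra)).
  apply Rabs_def2 in c1. apply Rabs_def2 in c2. apply Rabs_def2 in Pu.
  destruct (Rlt_le_dec (Rabs (om w - om 0)) (PI / 2)) as [H | H]; [exact H |].
  exfalso.
  assert (Hneg : cos (Rabs (om w - om 0)) <= 0).
  { apply cos_le_0; [exact H |].
    assert (Rabs (om w - om 0) < PI) by (apply Rabs_def1; lra). lra. }
  revert Hneg. unfold Rabs at 1. destruct (Rcase_abs _); rewrite ?cos_neg; lra.
Qed.

(** The cosine decreases away from 0, so that between 0 and [th] it is at least
    [1/2], and the sine has slope at least [1/2]. *)
Lemma angle_le_sine th : Rabs th < PI / 2 -> 1 / 2 <= cos th ->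
  Rabs th <= 2 * Rabs (sin th).
Proof.
intros Hth Hcos. assert (HPI := PI_RGT_0).
assert (Hpos : forall a, 0 <= a < PI / 2 -> 1 / 2 <= cos a -> a <= 2 * sin a).
{ intros a Ha Hca.
  destruct (MVT_gen sin 0 a cos) as [xi [Hxi E]];
    rewrite ?(Rmin_left 0 a), ?(Rmax_right 0 a) in * by lra.
  - intros. apply is_derive_Reals, derivable_pt_lim_sin.
  - intros. apply continuity_sin.
  - rewrite sin_0 in E.
    assert (cos a <= cos xi) by (apply cos_decr_1; lra). nra. }
unfold Rabs in *. destruct (Rcase_abs th) as [Hn | Hn].
- assert (H := Hpos (- th) ltac:(lra)). rewrite cos_neg, sin_neg in H.
  specialize (H Hcos). destruct (Rcase_abs (sin th)); lra.
- assert (H := Hpos th ltac:(lra) Hcos). destruct (Rcase_abs (sin th)); lra.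
Qed.

(** * The Kepler orbit and its perturbations *)

Section Orbit.

Variables (y w : R -> R * R) (T : R).
Hypothesis Horbit : kepler_orbit y w.
Hypothesis Hnoncircular : ~ circular y.
Hypothesis Hperiod : minimal_period y T.

Let z t : state := (y t, w t).

Lemma orbit_moves t : fst (z t) <> (0, 0) /\ moves z t (grav1 (z t)) (grav2 (z t)).
Proof using Horbit.
destruct (solves_moves _ _ _ _ t Horbit I) as [H0 Hm].
split; [exact H0 |].
assert (Hg := grad_phi (z t) H0).
change (fst (z t)) with (fst (y t, w t)) in Hg.
cbv beta in Hm. rewrite Hg in Hm.
rewrite <- (Ropp_involutive (grav1 (z t))), <- (Ropp_involutive (grav2 (z t))).
exact Hm.
Qed.

(** The period is one of the position alone; the velocity, its derivative,
    inherits it. *)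
Lemma orbit_closed : z T = z 0.
Proof using Horbit Hperiod.
destruct Hperiod as [_ [Hp _]].
assert (Hy : y T = y 0) by (rewrite <- (Hp 0); f_equal; ring).
unfold z. rewrite Hy. apply f_equal.
assert (Hsame : forall X V : state -> R,
  (forall s s', fst s = fst s' -> X s = X s') ->
  (forall t, is_derive (fun t => X (z t)) t (V (z t))) -> V (z T) = V (z 0)).
{ intros X V HX D.
  assert (Dt : is_derive (fun t => X (z (t + T))) 0 (V (z T))).
  { assert (Di : is_derive (fun t => t + T) 0 1).
    { eapply is_derive_value; [rates | ring]. }
    assert (DT := D T). replace T with (0 + T) in DT at 1 by ring.
    eapply is_derive_value.
    - exact (is_derive_comp (fun t => X (z t)) (fun t => t + T) 0 _ _ DT Di).
    - apply Rmult_1_l. }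
  rewrite <- (is_derive_unique _ _ _ Dt), <- (is_derive_unique _ _ _ (D 0)).
  apply Derive_ext. intro t. apply HX. apply Hp. }
rewrite (surjective_pairing (w T)), (surjective_pairing (w 0)).
apply f_equal2.
- apply (Hsame X1 V1); [unfold X1; intros s s' ->; reflexivity |].
  intro t. apply (orbit_moves t).
- apply (Hsame X2 V2); [unfold X2; intros s s' ->; reflexivity |].
  intro t. apply (orbit_moves t).
Qed.

(** Without angular momentum the radial velocity would decrease strictly. *)
Lemma orbit_angmom : angmom (z 0) <> 0.
Proof using Horbit Hperiod.
intro HL. assert (HT : 0 < T) by apply Hperiod.
assert (Hn : forall t, fst (z t) <> (0, 0)) by (intro; apply orbit_moves).
assert (Hm : forall t, moves z t (grav1 (z t)) (grav2 (z t))) by (intro; apply orbit_moves).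
assert (Hd : forall t, is_derive (fun t => radvel (z t)) t (- (1 / rad (z t) ^ 2))).
{ intro t. assert (Hr := rad_pos _ (Hn t)).
  assert (Hm0 : moves z t (grav1 (z t) + 0) (grav2 (z t) + 0))
    by (rewrite !Rplus_0_r; apply Hm).
  eapply is_derive_value; [exact (radvel_rate _ _ _ _ Hm0 (Hn t)) |].
  rewrite (angmom_constant z Hm Hn t), HL. field. lra. }
destruct (MVT_gen (fun t => radvel (z t)) 0 T (fun t => - (1 / rad (z t) ^ 2)))
  as [xi [_ E]].
- intros. apply Hd.
- intros t _. apply (derivable_continuous_at _ _ _ (Hd t)).
- rewrite orbit_closed in E. assert (Hr := rad_pos _ (Hn xi)).
  assert (0 < 1 / rad (z xi) ^ 2) by (apply Rdiv_lt_0_compat; [lra | apply pow_lt, Hr]).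
  nra.
Qed.

(** If [A = 0] the focal equation makes the radius constant. *)
Lemma orbit_eccentric : 0 < enorm (ecc1 (z 0), ecc2 (z 0)).
Proof using Horbit Hnoncircular.
assert (Hn : forall t, fst (z t) <> (0, 0)) by (intro; apply orbit_moves).
assert (Hm : forall t, moves z t (grav1 (z t)) (grav2 (z t))) by (intro; apply orbit_moves).
apply sqrt_lt_R0, sumsq_pos. intro Hz. injection Hz as Z1 Z2.
apply Hnoncircular. exists (angmom (z 0) ^ 2). intro t.
assert (Hf := focal_equation _ (Hn t)).
rewrite (ecc1_constant z Hm Hn t), (ecc2_constant z Hm Hn t),
  (angmom_constant z Hm Hn t), Z1, Z2 in Hf.
change (enorm (y t)) with (rad (z t)). lra.
Qed.

(** The angle is read off from the sine, that is from the cross product of the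
    initial and the final [A]. For step sizes below [rho / (8 (C + 1))], where
    [rho] is the initial norm, [A] stays within [rho / 4] of its initial value,
    and the cosine of the angle between the two above [1/2]. *)
Lemma magnetic_orders c f K : magnetic_order_one c f -> (1 <= K)%nat ->
  lrl_norm_error_order 2 f K (y 0) (w 0) T /\
  lrl_angle_error_order 2 f K (y 0) (w 0) T.
Proof using Horbit Hnoncircular Hperiod.
intros Hf HK.
assert (HT : 0 <= T) by (left; apply Hperiod).
destruct (lrl_drift_over_period z T c f K HT
  (fun t => proj2 (orbit_moves t)) (fun t => proj1 (orbit_moves t))
  orbit_angmom orbit_closed Hf HK) as [C [h0 [HC [Hh0 Hdrift]]]].
assert (Hfollow : forall h x v,
  solves (truncation f K h) (fun t => 0 <= t <= T) x v -> x 0 = y 0 -> v 0 = w 0 ->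
  follows z T f K h (fun t => (x t, v t))).
{ intros h x v Hs Hx Hv. split; [unfold z; rewrite Hx, Hv; reflexivity |].
  intros t Ht. exact (solves_moves _ _ _ _ t Hs Ht). }
split.
- exists (2 * C), h0. split; [exact Hh0 |]. intros h Hh x v Hs Hx Hv.
  destruct (Hdrift h _ Hh (Hfollow h x v Hs Hx Hv)) as [_ [E1 E2]].
  rewrite !lrl_pair, Hx, Hv. apply Rle_trans with (1 := enorm_lipschitz _ _).
  cbn [fst snd]. change (y 0, w 0) with (z 0). lra.
- assert (Hrho := orbit_eccentric).
  set (a1 := ecc1 (z 0)) in *. set (a2 := ecc2 (z 0)) in *.
  assert (Hrho2 := enorm_sq (a1, a2)). cbn [fst snd] in Hrho2.
  set (rho := enorm (a1, a2)) in *.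
  assert (Ha1 : Rabs a1 <= rho)
    by (apply abs_le_of_sq; [lra |]; assert (q := pow2_ge_0 a2); lra).
  assert (Ha2 : Rabs a2 <= rho)
    by (apply abs_le_of_sq; [lra |]; assert (q := pow2_ge_0 a1); lra).
  assert (Hq : 0 < rho / (8 * (C + 1))) by (apply Rdiv_lt_0_compat; lra).
  exists (8 * C / rho), (Rmin h0 (rho / (8 * (C + 1)))).
  split; [apply Rmin_pos; assumption |].
  intros h Hh x v Hs Hx Hv om Hom.
  assert (k1 := Rmin_l h0 (rho / (8 * (C + 1)))).
  assert (k2 := Rmin_r h0 (rho / (8 * (C + 1)))).
  assert (HCh : C * h <= rho / 8).
  { apply Rle_trans with ((C + 1) * (rho / (8 * (C + 1)))).
    - assert (0 <= C * (rho / (8 * (C + 1)) - h)) by (apply Rmult_le_pos; lra). nra.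
    - right. field. lra. }
  destruct (Hdrift h _ ltac:(lra) (Hfollow h x v Hs Hx Hv)) as [Hall [E1 E2]].
  cbv beta in Hall, E1, E2.
  set (N := fun t => enorm (lrl (x t) (v t))).
  assert (Hpol : forall t, 0 <= t <= T ->
    ecc1 (x t, v t) = N t * cos (om t) /\ ecc2 (x t, v t) = N t * sin (om t)).
  { intros t Ht. destruct (Hom t Ht) as [_ H]. fold (N t) in H.
    rewrite lrl_pair in H.
    change (scal (N t) (cos (om t), sin (om t)))
      with (N t * cos (om t), N t * sin (om t)) in H.
    injection H as H1 H2. split; assumption. }
  assert (HN0 : N 0 = rho).
  { unfold N, rho, a1, a2. rewrite lrl_pair, Hx, Hv. reflexivity. }
  assert (Hpol0 : a1 = rho * cos (om 0) /\ a2 = rho * sin (om 0)).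
  { destruct (Hpol 0 ltac:(lra)) as [P1 P2]. rewrite HN0, Hx, Hv in P1, P2.
    split; assumption. }
  assert (HN : forall t, 0 <= t <= T -> 3 / 4 * rho <= N t <= 5 / 4 * rho).
  { intros t Ht. destruct (Hall t Ht) as [F1 F2].
    assert (H := enorm_lipschitz (lrl (x t) (v t)) (a1, a2)).
    rewrite lrl_pair in H at 2 3. cbn [fst snd] in H.
    fold (N t) rho in H. apply Rabs_le_between in H.
    fold a1 in F1. fold a2 in F2. lra. }
  assert (Hmul : forall a b e, Rabs a <= rho -> Rabs b <= e -> Rabs (a * b) <= rho * e).
  { intros a b e Ha Hb. rewrite Rabs_mult.
    apply Rmult_le_compat; try apply Rabs_pos; assumption. }
  assert (Hcos : forall t, 0 <= t <= T -> 1 / 2 <= cos (om t - om 0)).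
  { intros t Ht. destruct (Hall t Ht) as [F1 F2]. fold a1 in F1. fold a2 in F2.
    destruct (Hpol t Ht) as [P1 P2]. specialize (HN t Ht).
    assert (G1 := Hmul _ _ _ Ha1 F1). assert (G2 := Hmul _ _ _ Ha2 F2).
    apply Rabs_le_between in G1. apply Rabs_le_between in G2.
    assert (Hrc : rho * (C * h) <= rho * (rho / 8)) by (apply Rmult_le_compat_l; lra).
    assert (Hdot : 3 / 4 * rho ^ 2 <= a1 * ecc1 (x t, v t) + a2 * ecc2 (x t, v t)) by lra.
    replace (a1 * ecc1 (x t, v t) + a2 * ecc2 (x t, v t))
      with (rho * N t * cos (om t - om 0)) in Hdot.
    - destruct (Rle_lt_dec (1 / 2) (cos (om t - om 0))) as [Hc | Hc]; [exact Hc |].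
      exfalso.
      assert (Hpos : 0 < rho * N t) by (apply Rmult_lt_0_compat; lra).
      assert (rho * N t * cos (om t - om 0) <= rho * N t * (1 / 2))
        by (apply Rmult_le_compat_l; lra).
      assert (rho * N t <= rho * (5 / 4 * rho)) by (apply Rmult_le_compat_l; lra).
      nra.
    - rewrite P1, P2, cos_minus. destruct Hpol0 as [Q1 Q2].
      rewrite Q1, Q2 at 1. ring. }
  assert (HTT : 0 <= T <= T) by lra.
  assert (Hsmall : Rabs (om T - om 0) < PI / 2).
  { apply angle_small; [exact HT | intros t Ht; apply (Hom t Ht) |].
    intros t Ht. specialize (Hcos t Ht). lra. }
  apply Rle_trans with (1 := angle_le_sine _ Hsmall (Hcos T HTT)).
  destruct (Hpol T HTT) as [P1 P2]. destruct Hpol0 as [Q1 Q2].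
  fold a1 in E1. fold a2 in E2.
  assert (Hsin : rho * N T * sin (om T - om 0)
    = a1 * (ecc2 (x T, v T) - a2) - a2 * (ecc1 (x T, v T) - a1)).
  { rewrite P1, P2, sin_minus. 
    replace (rho * N T * (sin (om T) * cos (om 0) - cos (om T) * sin (om 0)))
      with ((rho * cos (om 0)) * (N T * sin (om T)) - (rho * sin (om 0)) * (N T * cos (om T)))
      by ring.
    rewrite <- Q1, <- Q2. ring. }
  assert (G1 := Hmul _ _ _ Ha1 E2). assert (G2 := Hmul _ _ _ Ha2 E1).
  assert (Habs : rho * N T * Rabs (sin (om T - om 0)) <= 2 * (rho * (C * h ^ 2))).
  { specialize (HN T HTT).
    rewrite <- (Rabs_pos_eq (rho * N T)) by (apply Rmult_le_pos; lra).
    rewrite <- Rabs_mult, Hsin.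
    apply Rle_trans with (1 := Rabs_triang _ _). rewrite Rabs_Ropp. lra. }
  specialize (HN T HTT).
  assert (Hs0 := Rabs_pos (sin (om T - om 0))).
  apply Rmult_le_reg_l with (rho * (rho / 2));
    [apply Rmult_lt_0_compat; lra |].
  replace (rho * (rho / 2) * (8 * C / rho * h ^ 2)) with (2 * (2 * (rho * (C * h ^ 2))))
    by (field; lra).
  apply Rle_trans with (2 * (rho * N T * Rabs (sin (om T - om 0)))); [| lra].
  assert (rho * (rho / 2) <= rho * N T) by (apply Rmult_le_compat_l; lra).
  nra.
Qed.

End Orbit.

Theorem theorem4p6 (y w : R -> R * R) (T : R)
    (Horbit : kepler_orbit y w)
    (Helliptic : energy (y 0) (w 0) < 0)
    (Hnoncircular : ~ circular y)
    (Hperiod : minimal_period y T) :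
  (forall f : nat -> (R * R) * (R * R) -> R * R,
      modified_equation symplectic_euler f ->
      forall K : nat, (1 <= K)%nat ->
        lrl_norm_error_order 2 f K (y 0) (w 0) T /\
        lrl_angle_error_order 2 f K (y 0) (w 0) T)
  /\
  (forall phi1 phi2 : R * R -> R,
      (forall x, x <> (0, 0) -> phi x = phi1 x + phi2 x) ->
      (forall x, x <> (0, 0) -> phi1 x = phi2 x) ->
      forall f : nat -> (R * R) * (R * R) -> R * R,
      modified_equation
        (discrete_euler_lagrange (split_lagrangian phi1 phi2)) f ->
      forall K : nat, (1 <= K)%nat ->
        lrl_norm_error_order 2 f K (y 0) (w 0) T /\
        lrl_angle_error_order 2 f K (y 0) (w 0) T).
Proof.
split.
- intros f Hf K HK.
  apply (magnetic_orders y w T Horbit Hnoncircular Hperiod 0);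
    [apply symplectic_euler_magnetic, Hf | exact HK].
- intros phi1 phi2 Hsum Heq f Hf K HK.
  apply (magnetic_orders y w T Horbit Hnoncircular Hperiod 1);
    [apply (split_lagrangian_magnetic phi1 phi2); assumption | exact HK].
Qed.
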